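(* Let $\alpha$ be a finite Blaschke product with $m$ distinct zeros $a_1,\ldots,a_m$ and let $\beta$ be a finite Blaschke product with $n$ distinct zeros $b_1,\ldots,b_n$. Assume that $\alpha$ and $\beta$ have precisely $l$ zeros in common, namely $a_i=b_i$ for $i\leq l$ ($l=0$ if there are no zeros in common). Let $A$ be any linear transformation from $K_{\alpha}$ into $K_{\beta}$ and let $M_A=(r_{s,p})_{1\le s\le n,\,1\le p\le m}$ be the matrix representation of $A$ with respect to the bases $\{k_{a_1}^{\alpha},\ldots,k_{a_m}^{\alpha}\}$ of $K_\alpha$ and $\{k_{b_1}^{\beta},\ldots,k_{b_n}^{\beta}\}$ of $K_\beta$. (a) If $l=0$, then $A\in\mathscr{T}(\alpha,\beta)$ if and only if $$r_{s,p}=\frac{\overline{\beta'(b_s)}(\overline{a}_1-\overline{b}_s)r_{s,1}+\overline{\beta'(b_1)}(\overline{b}_1-\overline{a}_1)r_{1,1}+\overline{\beta'(b_1)}(\overline{a}_p-\overline{b}_1)r_{1,p}}{\overline{\beta'(b_s)}(\overline{a}_p-\overline{b}_s)}$$ for all $1\leq p\leq m$ and $1\leq s\leq n$. (b) If $l>0$, then $A\in\mathscr{T}(\alpha,\beta)$ if and only if $$r_{s,p}=\frac{\overline{\beta'(b_1)}(\overline{a}_1-\overline{b}_s)r_{1,s}+\overline{\beta'(b_1)}(\overline{a}_p-\overline{b}_1)r_{1,p}}{\overline{\beta'(b_s)}(\overline{a}_p-\overline{b}_s)}$$ for all $p,s$ such that $1\leq p\leq m$, $1\leq s\leq l$, $s\neq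 p$, and $$r_{s,p}=\frac{\overline{\beta'(b_s)}(\overline{a}_1-\overline{b}_s)r_{s,1}+\overline{\beta'(b_1)}(\overline{a}_p-\overline{b}_1)r_{1,p}}{\overline{\beta'(b_s)}(\overline{a}_p-\overline{b}_s)}$$ for all $p,s$ such that $1\leq p\leq m$, $l<s\leq n$.
   Context: $H^2$ is the classical Hardy space of the unit disk $\mathbb{D}$, identified via boundary values with a closed subspace of $L^2(\partial\mathbb{D})$. Here $m,n\ge 1$ and the finite Blaschke products are $$\alpha(z)=\prod_{i=1}^{m}\frac{a_i-z}{1-\overline{a}_iz},\qquad \beta(z)=\prod_{j=1}^{n}\frac{b_j-z}{1-\overline{b}_jz},\qquad a_i,b_j\in\mathbb{D},$$ with the $a_i$ pairwise distinct and the $b_j$ pairwise distinct. ''Precisely $l$ zeros in common'' means $\{a_1,\ldots,a_m\}\cap\{b_1,\ldots,b_n\}$ has exactly $l$ elements, and the zeros are indexed so that these are $a_i=b_i$, $1\le i\leq l$. The model space of an inner function $\alpha$ is $K_{\alpha}=H^2\ominus\alpha H^2$; $P_{\alpha}$ is the orthogonal projection from $L^2(\partial\mathbb{D})$ onto $K_\alpha$. For $w\in\mathbb{D}$ the reproducing kernel of $K_\alpha$ is $k_{w}^{\alpha}(z)=\frac{1-\overline{\alpha(w)}\alpha(z)}{1-\overline{w}z}$. For the finite Blaschke products $\alpha(z)=\prod_{i=1}^{m}\frac{a_i-z}{1-\overline{a}_iz}$ with pairwise distinct zeros $a_1,\ldots,a_m\in\mathbb{D}$ and $\beta(z)=\prod_{j=1}^{n}\frac{b_j-z}{1-\overline{b}_jz}$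 with pairwise distinct zeros $b_1,\ldots,b_n\in\mathbb{D}$, $\{k_{a_1}^{\alpha},\ldots,k_{a_m}^{\alpha}\}$ is a basis of $K_\alpha$ and $\{k_{b_1}^{\beta},\ldots,k_{b_n}^{\beta}\}$ is a basis of $K_\beta$; the matrix $M_A=(r_{s,p})$ is defined by $Ak_{a_p}^{\alpha}=\sum_{s=1}^{n}r_{s,p}k_{b_s}^{\beta}$, $p=1,\ldots,m$. For $\varphi\in L^2(\partial\mathbb{D})$ the asymmetric truncated Toeplitz operator $A_{\varphi}^{\alpha,\beta}\colon K_\alpha\to K_\beta$ is $A_{\varphi}^{\alpha,\beta}f=P_{\beta}(\varphi f)$ (functions in the finite-dimensional space $K_\alpha$ are bounded), and $\mathscr{T}(\alpha,\beta)=\{A_{\varphi}^{\alpha,\beta}\colon \varphi\in L^2(\partial\mathbb{D})\text{ and }A_{\varphi}^{\alpha,\beta}\text{ is bounded}\}$. *)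

(* Defs.v *)
From HB Require Import structures.
From mathcomp Require Import all_boot all_order all_algebra.
From mathcomp Require Import complex.
From mathcomp Require Import all_classical all_reals all_analysis.

Set Implicit Arguments.
Unset Strict Implicit.
Unset Printing Implicit Defensive.

Import Order.TTheory GRing.Theory Num.Theory.
Import numFieldNormedType.Exports.

Local Open Scope classical_set_scope.
Local Open Scope ring_scope.

(* The unit circle is parametrized by the angle t in [0, 2 pi]: a function on  *)
(* the circle is given as u : R -> R[i], where u t stands for u(e^{it}) and    *)
(* only the values on [0, 2 pi] matter.  Elements of L^2 of the circle are     *)
(* handled through representatives; equality in L^2 is the relation eq_circle. *)
(* R[i]^o is R[i] seen as a normed space over itself.                          *)

Section circle.
Variable R : realType.
Local Notation mu := (@lebesgue_measure R).
Local Notation D := (`[0, 2 * pi]%classic : set R).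
Implicit Types (u v : R -> R[i]) (t : R) (z : R[i]).

Definition expi t : R[i] := (cos t +i* sin t)%C.

Definition on_circle (F : R[i] -> R[i]) : R -> R[i] := fun t => F (expi t).

Definition sqmod z : R := complex.Re z ^+ 2 + complex.Im z ^+ 2.

Definition eq_circle u v : Prop := {ae mu, forall t, D t -> u t = v t}.

Definition L2 u : Prop :=
  [/\ measurable_fun D (fun t => complex.Re (u t)),
      measurable_fun D (fun t => complex.Im (u t))
    & (\int[mu]_(t in D) (sqmod (u t))%:E < +oo)%E].

Definition circle_mean u : R[i] :=
  (((2 * pi)^-1 * \int[mu]_(t in D) complex.Re (u t)) +i*
   ((2 * pi)^-1 * \int[mu]_(t in D) complex.Im (u t)))%C.

Definition inner u v : R[i] := circle_mean (fun t => u t * (v t)^*).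

Definition L2norm u : R :=
  Num.sqrt ((2 * pi)^-1 * \int[mu]_(t in D) sqmod (u t)).

(* F is, on the open unit disk, an element of the Hardy space: an analytic     *)
(* function whose Taylor coefficients at 0 are square summable.  The values of *)
(* F off the disk are irrelevant.                                              *)
Definition hardy_disk (F : R[i] -> R[i]) : Prop :=
  exists a : nat -> R[i],
    cvgn (series (fun k => sqmod (a k))) /\
    forall z : R[i], `|z| < 1 ->
      series (fun k => a k * z ^+ k : R[i]^o) @ \oo --> (F z : R[i]^o).

Definition boundary_value (F : R[i] -> R[i]) u : Prop :=
  {ae mu, forall t, D t ->
    (F (r%:C%C * expi t) : R[i]^o) @[r --> (1 : R)^'-] --> (u t : R[i]^o)}.

Definition H2 u : Prop :=
  L2 u /\ exists F : R[i] -> R[i], hardy_disk F /\ boundary_value F u.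

(* H^2 (-) theta H^2 *)
Definition model_space (theta : R[i] -> R[i]) u : Prop :=
  H2 u /\
  forall h, H2 h -> inner u (fun t => on_circle theta t * h t) = 0.

(* w is in L^2 and v is its orthogonal projection onto K *)
Definition orth_proj (K : (R -> R[i]) -> Prop) w v : Prop :=
  [/\ L2 w, K v & forall h, K h -> inner (fun t => w t - v t) h = 0].

(* A represents a linear transformation from K into K', where K and K' are     *)
(* taken modulo eq_circle.  The second clause includes compatibility with      *)
(* eq_circle (take c = 0).                                                     *)
Definition linear_transformation (K K' : (R -> R[i]) -> Prop)
    (A : (R -> R[i]) -> (R -> R[i])) : Prop :=
  (forall f, K f -> K' (A f)) /\
  (forall (c : R[i]) f g h, K f -> K g -> K h ->
     eq_circle h (fun t => c * f t + g t) ->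
     eq_circle (A h) (fun t => c * A f t + A g t)).

Definition bounded_operator (K : (R -> R[i]) -> Prop)
    (A : (R -> R[i]) -> (R -> R[i])) : Prop :=
  exists M : R, forall f, K f -> L2norm (A f) <= M * L2norm f.

Section toeplitz.
Variables alpha beta : R[i] -> R[i].

(* A f = P_beta (phi f) for all f in K_alpha; all such f are essentially       *)
(* bounded when alpha is a finite Blaschke product.                            *)
Definition is_ATTO (phi : R -> R[i]) (A : (R -> R[i]) -> (R -> R[i])) : Prop :=
  forall f, model_space alpha f ->
    orth_proj (model_space beta) (fun t => phi t * f t) (A f).

Definition ATTO (A : (R -> R[i]) -> (R -> R[i])) : Prop :=
  exists phi : R -> R[i],
    [/\ L2 phi, is_ATTO phi A & bounded_operator (model_space alpha) A].

End toeplitz.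

Definition blaschke k (a : 'I_k -> R[i]) (z : R[i]) : R[i] :=
  \prod_(i < k) ((a i - z) / (1 - (a i)^* * z)).

Definition kernel (theta : R[i] -> R[i]) (w z : R[i]) : R[i] :=
  (1 - (theta w)^* * theta z) / (1 - w^* * z).

Definition cderiv (F : R[i] -> R[i]) (z : R[i]) : R[i] :=
  derive1 (F : R[i]^o -> R[i]^o) z.

(* r is the matrix of A with respect to the kernels at the points of a and b   *)
Definition matrix_repr m n (a : 'I_m -> R[i]) (b : 'I_n -> R[i])
    (A : (R -> R[i]) -> (R -> R[i])) (r : 'M[R[i]]_(n, m)) : Prop :=
  forall p : 'I_m,
    eq_circle (A (on_circle (kernel (blaschke a) (a p))))
      (fun t => \sum_(s < n) r s p * on_circle (kernel (blaschke b) (b s)) t).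

End circle.

(* Main.v *)
Require Import Defs.
From HB Require Import structures.
From mathcomp Require Import all_boot all_order all_algebra.
From mathcomp Require Import complex.
From mathcomp Require Import all_classical all_reals all_analysis.
From mathcomp Require Import measurable_realfun ring lra.

Set Implicit Arguments.
Unset Strict Implicit.
Unset Printing Implicit Defensive.

Import Order.TTheory GRing.Theory Num.Theory.
Import numFieldNormedType.Exports.

Local Open Scope classical_set_scope.
Local Open Scope ring_scope.

(** Write [k_w = 1 / (1 - conj w z)]. At a zero [w] of a finite Blaschke product
    this is the reproducing kernel of its model space. The dual kernels
    [d_b = beta / (z - b)], for [b] a zero of [beta], also belong to the model space
    of [beta] and are biorthogonal to the [k_b]: the inner product of [k_c] and [d_b]
    is [0] if [c <> b] and the conjugate of [beta'(b)] if [c = b]. Hence the entry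
    [r_(s,p)] times the conjugate of [beta'(b_s)] is the inner product of
    [A k_(a_p)] and [d_(b_s)].

    If [A] has symbol [phi], this is the inner product of [phi k_(a_p)] and
    [d_(b_s)]. On the circle [conj d_b = conj beta z k_b], and partial fractions give
    [(conj a - conj b) z k_a k_b = k_a - k_b]. So the product of [r_(s,p)], of the
    conjugate of [beta'(b_s)] and of [conj a_p - conj b_s] is [U(a_p) - U(b_s)], where
    [U(w)] is the mean of [phi conj beta k_w] ([ATTO_separated]). Conversely, let [U]
    be any function on the zeros with this property. The mean of [conj Q z k_a k_b]
    is the conjugate of the divided difference of the polynomial [Q] at [a] and [b]
    ([mean_divided_difference]), so Hermite interpolation gives a polynomial for which
    the symbol [beta conj Q] has the prescribed matrix; its slopes at the common zeros
    account for the entries that the equations leave free ([separated_ATTO]).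
    Therefore [A] is a truncated Toeplitz operator exactly when the matrix with the
    weighted entries is a difference [U(a_p) - U(b_s)]. Such a matrix is determined by
    its first row and column, and the theorem says so in coordinates.

    The analytic facts about H^2 come from one estimate ([H2_energy]): a boundary
    function which is a radial limit almost everywhere has energy at most the sum of
    the square moduli of the Taylor coefficients. Applied to remainders, it shows that
    the Taylor series converges to the boundary function in L^2 ([H2_inner_cvg]), so
    Fourier and Taylor coefficients agree and [k_w] evaluates at [w]
    ([H2_reproducing]). That the kernels span the model space is then a linear
    recurrence: orthogonality to [theta] times [z^j] times the denominator of [theta]
    forces the Taylor coefficients to be combinations of the powers of the conjugate
    zeros ([model_span]). Boundedness of [A] is automatic, the coordinates of [f]
    being inner products with dual kernels ([A_bounded]). *)

(** * The complex plane and the unit circle *)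

Section ComplexPlane.
Variable R : realType.
Local Notation C := R[i].
Implicit Types z w : C.

Lemma ReM z w : complex.Re (z * w) =
  complex.Re z * complex.Re w - complex.Im z * complex.Im w.
Proof. by case: z w => x y []. Qed.

Lemma ImM z w : complex.Im (z * w) =
  complex.Re z * complex.Im w + complex.Im z * complex.Re w.
Proof. by case: z w => x y []. Qed.

Lemma ReD z w : complex.Re (z + w) = complex.Re z + complex.Re w.
Proof. by case: z w => x y []. Qed.

Lemma ImD z w : complex.Im (z + w) = complex.Im z + complex.Im w.
Proof. by case: z w => x y []. Qed.

Lemma ReJ z : complex.Re z^* = complex.Re z.
Proof. by case: z. Qed.

Lemma ImJ z : complex.Im z^* = - complex.Im z.
Proof. by case: z. Qed.

Lemma complex_eq z w : complex.Re z = complex.Re w ->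
  complex.Im z = complex.Im w -> z = w.
Proof. by case: z w => x y [x' y'] /= -> ->. Qed.

Lemma sqmod_ge0 z : 0 <= sqmod z.
Proof. by rewrite addr_ge0 ?sqr_ge0. Qed.

Lemma sqmodM z w : sqmod (z * w) = sqmod z * sqmod w.
Proof. by rewrite /sqmod ReM ImM; ring. Qed.

Lemma sqmodJ z : sqmod z^* = sqmod z.
Proof. by rewrite /sqmod ReJ ImJ sqrrN. Qed.

Lemma sqmodN z : sqmod (- z) = sqmod z.
Proof. by rewrite -mulN1r sqmodM /sqmod /= oppr0 expr0n addr0 sqrrN expr1n mul1r. Qed.

Lemma sqmod0 : sqmod (0 : C) = 0.
Proof. by rewrite /sqmod /= expr0n addr0. Qed.

Lemma sqmod1 : sqmod (1 : C) = 1.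
Proof. by rewrite /sqmod /= expr0n addr0 expr1n. Qed.

Lemma sqmod_eq0 z : sqmod z = 0 -> z = 0.
Proof.
rewrite /sqmod => /eqP; rewrite paddr_eq0 ?sqr_ge0// !sqrf_eq0.
move=> /andP[/eqP h1 /eqP h2].
exact: complex_eq.
Qed.

Lemma mulcJ z : z * z^* = (sqmod z)%:C%C.
Proof. by apply: complex_eq; rewrite ?ReM ?ImM ReJ ImJ /sqmod/=; ring. Qed.

Lemma sqmodE z : (sqmod z)%:C%C = `|z| ^+ 2.
Proof. by rewrite -mulcJ normCK. Qed.

Lemma sqmodX z n : sqmod (z ^+ n) = sqmod z ^+ n.
Proof. by elim: n => [|n IH]; rewrite ?sqmod1// !exprS sqmodM IH. Qed.

Lemma sqmodD_le z w : sqmod (z + w) <= 2 * sqmod z + 2 * sqmod w.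
Proof.
rewrite /sqmod ReD ImD.
have := sqr_ge0 (complex.Re z - complex.Re w); have := sqr_ge0 (complex.Im z - complex.Im w).
by nra.
Qed.

Lemma sqmod_lt1 z : `|z| < 1 -> sqmod z < 1.
Proof. by move=> z1; rewrite -ltcR sqmodE exprn_ilt1. Qed.

Lemma Re_le_sqmod z w : `|complex.Re (z * w)| <= sqmod z + sqmod w.
Proof.
rewrite ReM /sqmod ler_norml.
have := sqr_ge0 (complex.Re z - complex.Re w); have := sqr_ge0 (complex.Re z + complex.Re w).
have := sqr_ge0 (complex.Im z - complex.Im w); have := sqr_ge0 (complex.Im z + complex.Im w).
by nra.
Qed.

Lemma Im_le_sqmod z w : `|complex.Im (z * w)| <= sqmod z + sqmod w.
Proof.
rewrite ImM /sqmod ler_norml.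
have := sqr_ge0 (complex.Re z - complex.Im w); have := sqr_ge0 (complex.Re z + complex.Im w).
have := sqr_ge0 (complex.Im z - complex.Re w); have := sqr_ge0 (complex.Im z + complex.Re w).
by nra.
Qed.

Lemma sqmod_expi (t : R) : sqmod (expi t) = 1.
Proof. by rewrite /sqmod /= cos2Dsin2. Qed.

Lemma norm_expi (t : R) : `|expi t| = 1.
Proof.
by apply/eqP; rewrite -(@eqrXn2 _ 2)// expr1n -sqmodE sqmod_expi.
Qed.

Lemma expi_unit (t : R) : expi t != 0.
Proof. by rewrite -normr_eq0 norm_expi oner_eq0. Qed.

Lemma conj_expi (t : R) : (expi t)^* = (expi t)^-1.
Proof. by apply: (mulfI (expi_unit t)); rewrite mulcJ sqmod_expi divff ?expi_unit. Qed.

Lemma expiX (t : R) k : expi t ^+ k = expi (k%:R * t).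
Proof.
elim: k => [|k IH]; first by rewrite mul0r /expi cos0 sin0.
rewrite exprS IH -natr1 mulrDl mul1r /expi.
by apply: complex_eq; rewrite ?ReM ?ImM/= ?cosD ?sinD; ring.
Qed.

Lemma cvgc_Re_Im (T : Type) (F : set_system T) {FF : Filter F} (u : T -> C) (l : C) :
  u x @[x --> F] --> (l : C^o) ->
  complex.Re (u x) @[x --> F] --> complex.Re l /\
  complex.Im (u x) @[x --> F] --> complex.Im l.
Proof.
move=> /(@cvgrPdist_lt _ C^o) h.
have le_norm (z : C) (e : R) : `|z| < e%:C%C -> `|complex.Re z| < e /\ `|complex.Im z| < e.
  rewrite normc_def ltcR => ze.
  have e0 : 0 <= e by apply: le_trans (ltW ze); exact: sqrtr_ge0.
  split; apply: le_lt_trans ze; rewrite -sqrtr_sqr; apply: ler_wsqrtr.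
    by rewrite lerDl sqr_ge0.
  by rewrite lerDr sqr_ge0.
split; apply/cvgrPdist_lt => e e0; have e0' : 0 < e%:C%C by rewrite ltcR.
  near=> x; have /le_norm[] : `|l - u x| < e%:C%C by near: x; exact: h.
  by rewrite ReD raddfN.
near=> x; have /le_norm[] : `|l - u x| < e%:C%C by near: x; exact: h.
by rewrite ImD raddfN.
Unshelve. all: by end_near. Qed.

Lemma cvgc_sqmod (T : Type) (F : set_system T) {FF : Filter F} (u : T -> C) (l : C) :
  u x @[x --> F] --> (l : C^o) -> sqmod (u x) @[x --> F] --> sqmod l.
Proof.
by move=> /cvgc_Re_Im[h1 h2]; apply: cvgD; rewrite expr2; apply: cvgM.
Qed.

End ComplexPlane.

(** * Square-integrable functions and means on the circle *)

Section CircleMean.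
Variable R : realType.
Local Notation C := R[i].
Local Notation mu := (@lebesgue_measure R).
Local Notation D := (`[0, 2 * pi]%classic : set R).
Implicit Types (u v w : R -> C) (c : C).

Lemma twopi_gt0 : 0 < 2 * pi :> R.
Proof. by rewrite mulr_gt0 ?pi_gt0. Qed.

Lemma measurable_circle : measurable D.
Proof. exact: measurable_itv. Qed.
Local Notation mD := measurable_circle.

Lemma circle_length : mu D = (2 * pi)%:E.
Proof. by rewrite lebesgue_measure_itv/= lte_fin twopi_gt0 oppr0 addr0. Qed.

Lemma circle_length_lty : (mu D < +oo)%E.
Proof. by rewrite circle_length ltry. Qed.

Lemma Rintegral_circle_cst (x : R) : \int[mu]_(t in D) x = x * (2 * pi).
Proof.
transitivity (x * fine (mu D)); first exact: Rintegral_cst.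
by rewrite circle_length.
Qed.

Definition cmeasurable u : Prop :=
  measurable_fun D (fun t => complex.Re (u t)) /\
  measurable_fun D (fun t => complex.Im (u t)).

Definition cintegrable u : Prop :=
  mu.-integrable D (EFin \o (fun t => complex.Re (u t))) /\
  mu.-integrable D (EFin \o (fun t => complex.Im (u t))).

Lemma cmeasurableD u v : cmeasurable u -> cmeasurable v ->
  cmeasurable (fun t => u t + v t).
Proof.
move=> [u1 u2] [v1 v2]; split.
  under [X in measurable_fun _ X]eq_fun do rewrite ReD; exact: measurable_funD.
under [X in measurable_fun _ X]eq_fun do rewrite ImD; exact: measurable_funD.
Qed.

Lemma cmeasurableM u v : cmeasurable u -> cmeasurable v ->
  cmeasurable (fun t => u t * v t).
Proof.
move=> [u1 u2] [v1 v2]; split.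
  under [X in measurable_fun _ X]eq_fun do rewrite ReM.
  by apply: measurable_funB; apply: measurable_funM.
under [X in measurable_fun _ X]eq_fun do rewrite ImM.
by apply: measurable_funD; apply: measurable_funM.
Qed.

Lemma cmeasurableJ u : cmeasurable u -> cmeasurable (fun t => (u t)^*).
Proof.
move=> [u1 u2]; split; first by under [X in measurable_fun _ X]eq_fun do rewrite ReJ.
by under [X in measurable_fun _ X]eq_fun do rewrite ImJ; apply: measurableT_comp u2.
Qed.

Lemma cmeasurable_cst c : cmeasurable (fun=> c).
Proof. by split; exact: measurable_cst. Qed.

Lemma cmeasurable_expi : cmeasurable (@expi R).
Proof.
split; apply: measurable_funTS; apply: continuous_measurable_fun => t.
  exact: continuous_cos.
exact: continuous_sin.
Qed.

Lemma measurable_sqmod u : cmeasurable u -> measurable_fun D (fun t => sqmod (u t)).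
Proof.
by move=> [u1 u2]; apply: measurable_funD; apply: measurable_funX.
Qed.

Lemma cmeasurable_cvg (v : nat -> R -> C) u : (forall n, cmeasurable (v n)) ->
  (forall t, v n t @[n --> \oo] --> (u t : C^o)) -> cmeasurable u.
Proof.
move=> mv vu; split.
  apply: (@measurable_fun_cvg _ _ _ _ (fun n t => complex.Re (v n t))).
    by move=> n; case: (mv n).
  by move=> t _; case: (cvgc_Re_Im (vu t)).
apply: (@measurable_fun_cvg _ _ _ _ (fun n t => complex.Im (v n t))).
  by move=> n; case: (mv n).
by move=> t _; case: (cvgc_Re_Im (vu t)).
Qed.

Lemma L2_integrable u : L2 u <->
  cmeasurable u /\ mu.-integrable D (EFin \o (fun t => sqmod (u t))).
Proof.
have E : (\int[mu]_(t in D) `|(EFin \o (fun t => sqmod (u t))) t|)%E =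
    (\int[mu]_(t in D) (sqmod (u t))%:E)%E.
  by apply: eq_integral => t _ /=; rewrite ger0_norm ?sqmod_ge0.
split=> [[u1 u2 ufin]|[[u1 u2] /integrableP[_]]]; last by rewrite E.
have cu : cmeasurable u by [].
split=> //; apply/integrableP; split; last by rewrite E.
by apply/measurable_EFinP; exact: measurable_sqmod.
Qed.

Lemma L2_cmeasurable u : L2 u -> cmeasurable u.
Proof. by case/L2_integrable. Qed.

(** Domination is stated through square moduli, which gives the closure
    properties of L^2 without any norm inequality. *)
Lemma L2_dominated u v w : cmeasurable w -> L2 u -> L2 v ->
  (exists K, forall t, D t -> sqmod (w t) <= K * (sqmod (u t) + sqmod (v t))) -> L2 w.
Proof.
move=> mw /L2_integrable[mu1 iu] /L2_integrable[mv iv] [K wK].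
apply/L2_integrable; split=> //.
apply: (@le_integrable _ _ _ mu D mD _
  (EFin \o (fun t => K * (sqmod (u t) + sqmod (v t))))).
- by apply/measurable_EFinP; exact: measurable_sqmod.
- move=> t Dt /=; rewrite lee_fin ger0_norm ?sqmod_ge0//.
  exact: le_trans (wK t Dt) (ler_norm _).
under [X in _.-integrable _ X]eq_fun do rewrite /= EFinM EFinD.
by apply: integrableZl => //; apply: integrableD.
Qed.

Lemma L2_bounded u K : cmeasurable u -> (forall t, D t -> sqmod (u t) <= K) -> L2 u.
Proof.
move=> mu1 uK; apply/L2_integrable; split=> //.
apply: measurable_bounded_integrable => //.
- exact: circle_length_lty.
- exact: measurable_sqmod.
exists K; split; first exact: num_real.
move=> M KM t Dt; rewrite /= ger0_norm ?sqmod_ge0//.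
exact: le_trans (uK t Dt) (ltW KM).
Qed.

Lemma L2_cst c : L2 (fun=> c).
Proof. by apply: (@L2_bounded _ (sqmod c)) => //; exact: cmeasurable_cst. Qed.

Lemma L2D u v : L2 u -> L2 v -> L2 (fun t => u t + v t).
Proof.
move=> u2 v2; apply: (L2_dominated _ u2 v2).
  by apply: cmeasurableD; exact: L2_cmeasurable.
by exists 2 => t _; rewrite mulrDr sqmodD_le.
Qed.

Lemma L2M_bounded u v K : L2 u -> cmeasurable v ->
  (forall t, D t -> sqmod (v t) <= K) -> L2 (fun t => v t * u t).
Proof.
move=> u2 mv vK; apply: (L2_dominated _ u2 u2).
  by apply: cmeasurableM => //; exact: L2_cmeasurable.
exists K => t Dt; rewrite sqmodM.
have K0 : 0 <= K by apply: le_trans (vK t Dt); exact: sqmod_ge0.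
apply: ler_pM; rewrite ?sqmod_ge0 ?vK//.
by rewrite lerDl sqmod_ge0.
Qed.

Lemma L2Z c u : L2 u -> L2 (fun t => c * u t).
Proof. by move=> u2; apply: (L2M_bounded u2 (cmeasurable_cst c) (K := sqmod c)). Qed.

Lemma L2B u v : L2 u -> L2 v -> L2 (fun t => u t - v t).
Proof.
move=> u2 v2; have := L2D u2 (L2Z (-1) v2).
by under eq_fun do rewrite mulN1r.
Qed.

Lemma L2J u : L2 u -> L2 (fun t => (u t)^*).
Proof.
move=> u2; apply: (L2_dominated _ u2 u2).
  by apply: cmeasurableJ; exact: L2_cmeasurable.
by exists 1 => t _; rewrite sqmodJ mul1r lerDl sqmod_ge0.
Qed.

Lemma L2_sum (I : Type) (s : seq I) (f : I -> R -> C) :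
  (forall i, L2 (f i)) -> L2 (fun t => \sum_(i <- s) f i t).
Proof.
move=> f2; elim: s => [|i s IH].
  by under eq_fun do rewrite big_nil; exact: L2_cst.
by under eq_fun do rewrite big_cons; exact: L2D.
Qed.

Lemma cintegrable_mul u v : L2 u -> L2 v -> cintegrable (fun t => u t * v t).
Proof.
move=> /[dup] u2 /L2_integrable[mu1 iu] /[dup] v2 /L2_integrable[mv iv].
have [m1 m2] := cmeasurableM mu1 mv.
have iuv : mu.-integrable D (EFin \o (fun t => sqmod (u t) + sqmod (v t))).
  under [X in _.-integrable _ X]eq_fun do rewrite /= EFinD.
  exact: integrableD.
split; apply: (@le_integrable _ _ _ mu D mD _ _ _ _ iuv); try exact/measurable_EFinP.
  move=> t Dt; rewrite lee_fin; apply: le_trans (ler_norm _).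
  exact: Re_le_sqmod.
move=> t Dt; rewrite lee_fin; apply: le_trans (ler_norm _).
exact: Im_le_sqmod.
Qed.

Lemma cintegrable_L2 u : L2 u -> cintegrable u.
Proof.
move=> u2; have := cintegrable_mul u2 (L2_cst 1).
by under eq_fun do rewrite mulr1.
Qed.

Lemma cintegrableD u v : cintegrable u -> cintegrable v ->
  cintegrable (fun t => u t + v t).
Proof.
move=> [u1 u2] [v1 v2]; split.
  under [X in _.-integrable _ X]eq_fun do rewrite /= ReD EFinD.
  exact: integrableD.
under [X in _.-integrable _ X]eq_fun do rewrite /= ImD EFinD.
exact: integrableD.
Qed.

Lemma cintegrableZ c u : cintegrable u -> cintegrable (fun t => c * u t).
Proof.
move=> [u1 u2]; split.
  under [X in _.-integrable _ X]eq_fun do rewrite /= ReM EFinB !EFinM.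
  by apply: integrableB => //; apply: integrableZl.
under [X in _.-integrable _ X]eq_fun do rewrite /= ImM EFinD !EFinM.
by apply: integrableD => //; apply: integrableZl.
Qed.

Lemma circle_meanD u v : cintegrable u -> cintegrable v ->
  circle_mean (fun t => u t + v t) = circle_mean u + circle_mean v.
Proof.
move=> [u1 u2] [v1 v2]; apply: complex_eq.
  rewrite /circle_mean ReD /=; under eq_Rintegral do rewrite ReD.
  by rewrite RintegralD// mulrDr.
rewrite /circle_mean ImD /=; under eq_Rintegral do rewrite ImD.
by rewrite RintegralD// mulrDr.
Qed.

Lemma circle_meanZ c u : cintegrable u ->
  circle_mean (fun t => c * u t) = c * circle_mean u.
Proof.
move=> [u1 u2].
have rZ r (f : R -> R) : mu.-integrable D (EFin \o f) ->
    mu.-integrable D (EFin \o (fun t => r * f t)).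
  move=> fi; under [X in _.-integrable _ X]eq_fun do rewrite /= EFinM.
  exact: integrableZl.
apply: complex_eq.
  rewrite /circle_mean ReM /=; under eq_Rintegral do rewrite ReM.
  by rewrite RintegralB ?RintegralZl//; [ring|exact: rZ..].
rewrite /circle_mean ImM /=; under eq_Rintegral do rewrite ImM.
by rewrite RintegralD ?RintegralZl//; [ring|exact: rZ..].
Qed.

Lemma circle_mean_sum (I : Type) (s : seq I) (f : I -> R -> C) :
  (forall i, cintegrable (f i)) ->
  circle_mean (fun t => \sum_(i <- s) f i t) = \sum_(i <- s) circle_mean (f i) /\
  cintegrable (fun t => \sum_(i <- s) f i t).
Proof.
move=> f1; elim: s => [|i s [IH1 IH2]].
  under eq_fun do rewrite big_nil; rewrite big_nil.
  split; last by apply: cintegrable_L2; exact: L2_cst.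
  rewrite -[RHS](mul0r (circle_mean (fun=> 0 : C))).
  rewrite -circle_meanZ; last by apply: cintegrable_L2; exact: L2_cst.
  by congr circle_mean; apply/funext => t; rewrite mul0r.
under eq_fun do rewrite big_cons; split; last exact: cintegrableD.
by rewrite circle_meanD// IH1 big_cons.
Qed.

Lemma circle_meanJ u : cintegrable u ->
  circle_mean (fun t => (u t)^*) = (circle_mean u)^*.
Proof.
move=> [u1 u2]; apply: complex_eq.
  by rewrite ReJ /circle_mean /=; under eq_Rintegral do rewrite ReJ.
rewrite ImJ /circle_mean /=; under eq_Rintegral do rewrite ImJ -mulN1r.
by rewrite RintegralZl//; ring.
Qed.

Lemma circle_aeS (P Q : R -> Prop) : (forall t, P t -> Q t) ->
  {ae mu, forall t, P t} -> {ae mu, forall t, Q t}.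
Proof. exact: (@filterS _ _ (ae_filter_ringOfSetsType mu)). Qed.

Lemma circle_aeS2 (P1 P2 Q : R -> Prop) : (forall t, P1 t -> P2 t -> Q t) ->
  {ae mu, forall t, P1 t} -> {ae mu, forall t, P2 t} -> {ae mu, forall t, Q t}.
Proof. exact: (@filterS2 _ _ (ae_filter_ringOfSetsType mu)). Qed.

Lemma eq_circle_refl u : eq_circle u u.
Proof. exact: aeW. Qed.

Lemma eq_circle_trans u v w : eq_circle u v -> eq_circle v w -> eq_circle u w.
Proof. by apply: circle_aeS2 => t uv vw Dt; rewrite uv ?vw. Qed.

Lemma eq_circleM u v u' v' : eq_circle u u' -> eq_circle v v' ->
  eq_circle (fun t => u t * v t) (fun t => u' t * v' t).
Proof. by apply: circle_aeS2 => t uv vw Dt; rewrite uv ?vw. Qed.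

Lemma eq_circleJ u v : eq_circle u v ->
  eq_circle (fun t => (u t)^*) (fun t => (v t)^*).
Proof. by apply: circle_aeS => t uv Dt; rewrite uv. Qed.

Lemma eq_circle_mean u v : cmeasurable u -> cmeasurable v -> eq_circle u v ->
  circle_mean u = circle_mean v.
Proof.
move=> [u1 u2] [v1 v2] uv; rewrite /circle_mean /Rintegral.
congr Complex; congr *%R; congr fine.
  apply: ae_eq_integral => //; try exact/measurable_EFinP.
  by move: uv; apply: circle_aeS => t h Dt /=; rewrite h.
apply: ae_eq_integral => //; try exact/measurable_EFinP.
by move: uv; apply: circle_aeS => t h Dt /=; rewrite h.
Qed.

(** Real and imaginary parts are the integrals over whole periods of cosine and
    sine, computed from primitives. *)
Lemma circle_mean_expi k : circle_mean (fun t : R => expi t ^+ k.+1) = 0.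
Proof.
under eq_fun do rewrite expiX; rewrite /circle_mean /expi /=.
have k0 : k.+1%:R != 0 :> R by rewrite pnatr_eq0.
have dk (x : R) : is_derive x (1 : R) (fun t : R => k.+1%:R * t : R) (k.+1%:R : R).
  apply: is_derive_eq.
  by rewrite -[LHS]/(k.+1%:R * 1) mulr1.
have cont (f : R -> R) : continuous f ->
    {within `[0, 2 * pi], continuous (fun t : R => f (k.+1%:R * t))}.
  move=> cf; apply: continuous_subspaceT => t.
  apply: (@continuous_comp _ _ _ (fun t : R => k.+1%:R * t) f); last exact: cf.
  exact: mulrl_continuous.
have FTC (f F : R -> R) : continuous f -> (forall x : R, is_derive x (1 : R) F (f x)) ->
    F (k.+1%:R * (2 * pi)) = F 0 ->
    \int[mu]_(t in D) f (k.+1%:R * t) = 0.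
  move=> cf dF F0; rewrite /Rintegral.
  have dG (x : R) : is_derive x (1 : R) (fun t : R => k.+1%:R^-1 * F (k.+1%:R * t))
      (f (k.+1%:R * x)).
    have h := is_derive1_comp (dF (k.+1%:R * x)) (dk x).
    apply: is_derive_eq.
    by rewrite -[LHS]/(_ * (_ * _)) mulrC -mulrA mulrV ?mulr1 ?unitfE.
  have cG : continuous (fun t : R => k.+1%:R^-1 * F (k.+1%:R * t) : R).
    by move=> x; apply/differentiable_continuous/derivable1_diffP; case: (dG x).
  rewrite (continuous_FTC2 twopi_gt0 (cont _ cf)
    (F := fun t => k.+1%:R^-1 * F (k.+1%:R * t))).
  - by rewrite mulr0 F0 subee.
  - split=> [x _||].
    + by case: (dG x).
    + by apply: cvg_at_right_filter; exact: cG.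
    + by apply: cvg_at_left_filter; exact: cG.
  - by move=> x _; rewrite derive1E; apply: derive_val.
have per : sin (k.+1%:R * (2 * pi)) = 0 :> R /\ cos (k.+1%:R * (2 * pi)) = 1 :> R.
  elim: k.+1 => [|j [h1 h2]]; first by rewrite mul0r sin0 cos0.
  rewrite -natr1 mulrDl mul1r (mulr_natl pi 2).
  by rewrite sinD2pi cosD2pi -(mulr_natl pi 2).
have dNcos (x : R) : is_derive x (1 : R) (fun x : R => - cos x : R) (sin x).
  by apply: is_derive_eq; rewrite opprK.
rewrite (FTC _ _ (@continuous_cos R) (@is_derive_sin R)); last by rewrite sin0 per.1.
rewrite (FTC _ _ (@continuous_sin R) dNcos); last by rewrite cos0 per.2.
by rewrite mulr0.
Qed.

End CircleMean.

(** * Inner product, trigonometric sums and Fatou's lemma *)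

Section InnerProduct.
Variable R : realType.
Local Notation C := R[i].
Local Notation mu := (@lebesgue_measure R).
Local Notation D := (`[0, 2 * pi]%classic : set R).
Implicit Types (u v w : R -> C) (c : C).

Let mD : measurable D := @measurable_circle R.

Lemma cintegrable_inner u v : L2 u -> L2 v -> cintegrable (fun t => u t * (v t)^*).
Proof. by move=> u2 v2; apply: cintegrable_mul => //; exact: L2J. Qed.

Lemma innerDl u v w : L2 u -> L2 v -> L2 w ->
  inner (fun t => u t + v t) w = inner u w + inner v w.
Proof.
move=> u2 v2 w2; rewrite /inner -circle_meanD; try exact: cintegrable_inner.
by congr circle_mean; apply/funext => t; rewrite mulrDl.
Qed.

Lemma innerZl c u w : L2 u -> L2 w -> inner (fun t => c * u t) w = c * inner u w.
Proof.
move=> u2 w2; rewrite /inner -circle_meanZ; last exact: cintegrable_inner.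
by congr circle_mean; apply/funext => t; rewrite mulrA.
Qed.

Lemma inner_conj u v : L2 u -> L2 v -> inner v u = (inner u v)^*.
Proof.
move=> u2 v2; rewrite /inner -circle_meanJ; last exact: cintegrable_inner.
by congr circle_mean; apply/funext => t; rewrite rmorphM /= conjCK mulrC.
Qed.

Lemma innerDr u v w : L2 u -> L2 v -> L2 w ->
  inner w (fun t => u t + v t) = inner w u + inner w v.
Proof.
move=> u2 v2 w2; rewrite inner_conj//; last exact: L2D.
by rewrite innerDl// rmorphD /= -!inner_conj.
Qed.

Lemma innerZr c u w : L2 u -> L2 w -> inner w (fun t => c * u t) = c^* * inner w u.
Proof.
move=> u2 w2; rewrite inner_conj//; last exact: L2Z.
by rewrite innerZl// rmorphM /= -inner_conj.
Qed.

Lemma innerBl u v w : L2 u -> L2 v -> L2 w ->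
  inner (fun t => u t - v t) w = inner u w - inner v w.
Proof.
move=> u2 v2 w2; have -> : (fun t => u t - v t) = (fun t => u t + -1 * v t).
  by apply/funext => t; rewrite mulN1r.
by rewrite innerDl ?innerZl ?mulN1r//; exact: L2Z.
Qed.

Lemma inner_suml (I : Type) (s : seq I) (f : I -> R -> C) w :
  (forall i, L2 (f i)) -> L2 w ->
  inner (fun t => \sum_(i <- s) f i t) w = \sum_(i <- s) inner (f i) w.
Proof.
move=> f2 w2; rewrite /inner.
rewrite -(circle_mean_sum s (fun i => cintegrable_inner (f2 i) w2)).1.
by congr circle_mean; apply/funext => t; rewrite mulr_suml.
Qed.

Lemma inner_sumr (I : Type) (s : seq I) (f : I -> R -> C) w :
  (forall i, L2 (f i)) -> L2 w ->
  inner w (fun t => \sum_(i <- s) f i t) = \sum_(i <- s) inner w (f i).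
Proof.
move=> f2 w2; rewrite inner_conj//; last exact: L2_sum.
rewrite inner_suml// rmorph_sum.
by apply: eq_bigr => i _ /=; rewrite -inner_conj.
Qed.

Lemma eq_circle_inner u u' v v' : cmeasurable u -> cmeasurable u' ->
  cmeasurable v -> cmeasurable v' -> eq_circle u u' -> eq_circle v v' ->
  inner u v = inner u' v'.
Proof.
move=> mu1 mu2 mv1 mv2 uu' vv'; apply: eq_circle_mean.
- by apply: cmeasurableM => //; exact: cmeasurableJ.
- by apply: cmeasurableM => //; exact: cmeasurableJ.
- by apply: eq_circleM => //; exact: eq_circleJ.
Qed.

Lemma inner0_eq_circle u w : cmeasurable u -> L2 w -> eq_circle u (fun=> 0) ->
  inner u w = 0.
Proof.
move=> mu1 w2 u0; have mw := L2_cmeasurable w2.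
rewrite (eq_circle_inner mu1 (cmeasurable_cst 0) mw mw u0 (eq_circle_refl w)).
under [X in inner X _]eq_fun do rewrite -(mul0r 1).
by rewrite innerZl ?mul0r//; exact: L2_cst.
Qed.

Lemma L2norm_sqr u : L2norm u ^+ 2 = (2 * pi)^-1 * \int[mu]_(t in D) sqmod (u t).
Proof.
rewrite sqr_sqrtr//; apply: mulr_ge0.
  by rewrite invr_ge0 ltW ?twopi_gt0.
by apply: Rintegral_ge0 => t _; exact: sqmod_ge0.
Qed.

Lemma inner_self u : inner u u = (L2norm u ^+ 2)%:C%C.
Proof.
rewrite L2norm_sqr /inner; apply: complex_eq; rewrite /circle_mean/=.
  by under eq_Rintegral do rewrite mulcJ.
under eq_Rintegral do rewrite mulcJ.
by rewrite Rintegral_circle_cst mul0r mulr0.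
Qed.

Lemma L2norm_ge0 u : 0 <= L2norm u.
Proof. exact: sqrtr_ge0. Qed.

(** Positivity of the norm of [x u - y p v], where [p] is the inner product and
    [x], [y] are real; the choices of [x] and [y] avoid any division. *)
Lemma Cauchy_Schwarz u v : L2 u -> L2 v ->
  sqmod (inner u v) <= L2norm u ^+ 2 * L2norm v ^+ 2.
Proof.
move=> u2 v2; set p := inner u v; set A := L2norm u ^+ 2; set B := L2norm v ^+ 2.
have A0 : 0 <= A by exact: sqr_ge0.
have B0 : 0 <= B by exact: sqr_ge0.
have key (x y : R) : 0 <= x ^+ 2 * A - 2 * x * y * sqmod p + y ^+ 2 * sqmod p * B.
  pose w := fun t => x%:C%C * u t + (- y%:C%C * p) * v t.
  have w2 : L2 w by apply: L2D; exact: L2Z.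
  have : 0 <= L2norm w ^+ 2 by exact: sqr_ge0.
  rewrite -ler0c -inner_self {1}/w innerDl//; try exact: L2Z.
  rewrite !innerZl// /w !innerDr//; try exact: L2Z.
  rewrite !innerZr// !inner_self -/A -/B (inner_conj u2 v2) -/p.
  suff -> : x%:C%C * ((x%:C%C)^* * A%:C%C + (- y%:C%C * p)^* * p) +
      - y%:C%C * p * ((x%:C%C)^* * p^* + (- y%:C%C * p)^* * B%:C%C) =
      (x ^+ 2 * A - 2 * x * y * sqmod p + y ^+ 2 * sqmod p * B)%:C%C by rewrite ler0c.
  clear w w2; clearbody p; case: p => p1 p2.
  by apply: complex_eq; rewrite /sqmod /=; ring.
have S0 := sqmod_ge0 p.
have [Bp|Bp] := ltrP 0 B.
  have := key B 1; rewrite -/(0 <= _) => h.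
  have : 0 <= B * (A * B - sqmod p) by move: h; congr (_ <= _); ring.
  by rewrite pmulr_rge0// subr_ge0.
have {}B0 : B = 0 by apply/eqP; rewrite eq_le Bp B0.
have [Ap|Ap] := ltrP 0 A.
  have := key (sqmod p) A; rewrite B0 mulr0 => h.
  rewrite mulr0 leNgt; apply/negP => p0.
  have : 0 < sqmod p ^+ 2 * A by apply: mulr_gt0 => //; exact: exprn_gt0.
  by nra.
have {}A0 : A = 0 by apply/eqP; rewrite eq_le Ap A0.
by have := key 1 1; rewrite A0 B0; lra.
Qed.

Lemma L2_expi k : L2 (fun t : R => expi t ^+ k).
Proof.
apply: (@L2_bounded _ _ 1) => [|t _]; last by rewrite sqmodX sqmod_expi expr1n.
elim: k => [|k IH]; first exact: cmeasurable_cst.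
under eq_fun do rewrite exprS.
by apply: cmeasurableM => //; exact: cmeasurable_expi.
Qed.

Lemma inner_expi j k :
  inner (fun t : R => expi t ^+ j) (fun t => expi t ^+ k) = (j == k)%:R.
Proof.
wlog jk : j k / (k <= j)%N.
  move=> H; have [|/ltnW jk] := leqP k j; first exact: H.
  by rewrite inner_conj ?H 1?eq_sym ?conjC_nat//; exact: L2_expi.
rewrite /inner; under eq_fun do rewrite rmorphXn /= conj_expi.
under eq_fun do rewrite exprVn -expfB_cond ?(negbTE (expi_unit _)) ?orFb//=.
case: eqP => [->|/eqP njk].
  under eq_fun do rewrite subnn expr0.
  rewrite /circle_mean /=; apply: complex_eq => /=.
    rewrite Rintegral_circle_cst mul1r mulVf// lt0r_neq0//.
    exact: twopi_gt0.
  by rewrite Rintegral_circle_cst mul0r mulr0.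
have : (0 < j - k)%N by rewrite subn_gt0 ltn_neqAle eq_sym njk.
by case: (j - k)%N => // d _; exact: circle_mean_expi.
Qed.

Definition trig_sum (a : nat -> C) N (t : R) : C := \sum_(0 <= k < N) a k * expi t ^+ k.

Lemma L2_trig_sum a N : L2 (trig_sum a N).
Proof. by apply: L2_sum => k; apply: L2Z; exact: L2_expi. Qed.

Lemma inner_trig_sum a N w : L2 w ->
  inner (trig_sum a N) w = \sum_(0 <= k < N) a k * inner (fun t => expi t ^+ k) w.
Proof.
move=> w2; rewrite inner_suml//; last by move=> k; apply: L2Z; exact: L2_expi.
by apply: eq_bigr => k _; rewrite innerZl//; exact: L2_expi.
Qed.

Lemma inner_trig_sum_expi a N j : (j < N)%N ->
  inner (trig_sum a N) (fun t => expi t ^+ j) = a j.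
Proof.
move=> jN; rewrite inner_trig_sum; last exact: L2_expi.
rewrite big_mkord (bigD1 (Ordinal jN))//= inner_expi eqxx mulr1 big1 ?addr0//.
by move=> k kj; rewrite inner_expi -[_ == j]/(k == Ordinal jN) (negbTE kj) mulr0.
Qed.

Lemma L2norm_trig_sum a N : L2norm (trig_sum a N) ^+ 2 = \sum_(0 <= k < N) sqmod (a k).
Proof.
apply: complexI; rewrite -inner_self inner_trig_sum; last exact: L2_trig_sum.
rewrite raddf_sum; apply: eq_big_nat => k /= kN.
rewrite inner_conj; [|exact: L2_trig_sum|exact: L2_expi].
by rewrite inner_trig_sum_expi// mulcJ.
Qed.

Lemma integral_sqmod u : L2 u ->
  (\int[mu]_(t in D) (sqmod (u t))%:E)%E = (2 * pi * L2norm u ^+ 2)%:E.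
Proof.
move=> /L2_integrable[_ iu].
rewrite L2norm_sqr mulrA divff ?mul1r ?lt0r_neq0 ?twopi_gt0//.
by rewrite /Rintegral fineK//; exact: integrable_fin_num.
Qed.

Lemma L2norm0_eq_circle u : L2 u -> L2norm u = 0 -> eq_circle u (fun=> 0).
Proof.
move=> u2 u0; have := integral_sqmod u2.
rewrite u0 expr0n mulr0 => i0.
have [mu1 _] := (L2_integrable u).1 u2.
have := @ae_eq_integral_abs _ _ _ mu D mD (EFin \o (fun t => sqmod (u t))).
move=> /(_ _)[|+ _].
  by apply/measurable_EFinP; exact: measurable_sqmod.
move=> /(_ _)/cid[].
  rewrite -[RHS]i0; apply: eq_integral => t _ /=.
  by rewrite ger0_norm ?sqmod_ge0.
move=> h1 h2; exists h1; move: h2 => [? ? h]; split => //.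
apply: subset_trans h => t /= nu h; apply: nu => Dt.
by apply: sqmod_eq0; have := h Dt => -[].
Qed.

Lemma L2_le_integral u K : cmeasurable u ->
  (\int[mu]_(t in D) (sqmod (u t))%:E <= (2 * pi * K)%:E)%E ->
  L2 u /\ L2norm u ^+ 2 <= K.
Proof.
move=> [m1 m2] uK; have u2 : L2 u by split=> //; apply: le_lt_trans uK _; exact: ltry.
split=> //; move: uK; rewrite integral_sqmod// lee_fin ler_pM2l//.
exact: twopi_gt0.
Qed.

(** Fatou's lemma off the null set where convergence fails. *)
Lemma fatou_sqmod (v : nat -> R -> C) u K : (forall n, cmeasurable (v n)) ->
  cmeasurable u -> (forall n, (\int[mu]_(t in D) (sqmod (v n t))%:E <= K%:E)%E) ->
  {ae mu, forall t, D t -> v n t @[n --> \oo] --> (u t : C^o)} ->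
  (\int[mu]_(t in D) (sqmod (u t))%:E <= K%:E)%E.
Proof.
move=> mv mu1 vK [N [mN N0 subN]].
have mE w : cmeasurable w -> measurable_fun D (fun t => (sqmod (w t))%:E).
  by move=> mw; apply/measurable_EFinP; exact: measurable_sqmod.
have ge0 w (t : R) : (0 <= (sqmod (w t : C))%:E)%E by rewrite lee_fin sqmod_ge0.
rewrite (ge0_negligible_integral mN mD (mE _ mu1))//.
have mDN : measurable (D `\` N) by exact: measurableD.
have mE' w : cmeasurable w -> measurable_fun (D `\` N) (fun t => (sqmod (w t))%:E).
  by move=> mw; apply: measurable_funS (mE _ mw) => // t [].
have := @fatou _ _ _ mu _ mDN (fun n t => (sqmod (v n t))%:E)
  (fun n => mE' _ (mv n)) (fun n t _ => ge0 (v n) t).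
rewrite [X in (X <= _)%E -> _](_ : _ =
  \int[mu]_(t in D `\` N) (sqmod (u t))%:E)%E; last first.
  apply: eq_integral => t; rewrite inE => -[Dt Nt].
  have vu : v n t @[n --> \oo] --> (u t : C^o).
    by apply: contrapT => h; apply: Nt; apply: subN => /= h2; apply: h; exact: h2.
  by apply: (cvg_limn_einf_sup _).1; apply: cvg_EFin; [exact: nearW|exact: cvgc_sqmod].
move=> /le_trans; apply; rewrite limn_einf_lim; apply: lime_le.
  exact: is_cvg_einfs.
apply: nearW => n; apply: le_trans (vK n).
apply: le_trans (_ : (\int[mu]_(t in D `\` N) (sqmod (v n t))%:E <= _)%E).
  by apply: ereal_inf_lbound; exists n => /=.
by apply: ge0_subset_integral => //; exact: mE.
Qed.

End InnerProduct.

(** * Power series in the disk and their radial boundary values *)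

Section HardySpace.
Variable R : realType.
Local Notation C := R[i].
Local Notation mu := (@lebesgue_measure R).
Local Notation D := (`[0, 2 * pi]%classic : set R).
Implicit Types (a b : nat -> C) (F G : C -> C) (u v w : R -> C) (c z : C).

Lemma cvgc_sqmod0 (T : Type) (P : set_system T) {FP : Filter P} (f : T -> C) (l : C) :
  sqmod (f x - l) @[x --> P] --> 0 -> f x @[x --> P] --> (l : C^o).
Proof.
move=> /cvgrPdist_lt h; apply/(@cvgrPdist_lt _ C^o) => e e0.
have [r r0 ->] : exists2 r : R, 0 < r & e = r%:C%C.
  exists (complex.Re e); first by move: e0; rewrite ltcE => /andP[].
  by apply: complex_eq => //=; move: e0; rewrite ltcE => /andP[/eqP].
have := h (r ^+ 2); rewrite exprn_gt0// => /(_ isT); apply: filterS => x.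
rewrite sub0r normrN ger0_norm ?sqmod_ge0// distrC => hx.
have : `|f x - l| ^+ 2 < r%:C%C ^+ 2 by rewrite -sqmodE -rmorphXn ltcR.
by rewrite ltr_pXn2r// ?nnegrE ?ler0c ?ltW.
Qed.

Lemma cvg_geometric_sqmod (q K : R) : 0 <= q < 1 -> K * q ^+ n @[n --> \oo] --> 0.
Proof.
move=> /andP[q0 q1]; rewrite -[X in _ --> X](mulr0 K); apply: cvgMr.
by apply: cvg_expr; rewrite ger0_norm.
Qed.

Lemma cvgc_geometric z : `|z| < 1 ->
  \sum_(0 <= k < n) z ^+ k @[n --> \oo] --> ((1 - z)^-1 : C^o).
Proof.
move=> z1; have z1' : 1 - z != 0.
  by apply: contraTneq z1 => /eqP; rewrite subr_eq0 => /eqP <-; rewrite normr1 ltxx.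
have E n : \sum_(0 <= k < n) z ^+ k = (1 - z)^-1 * (1 - z ^+ n).
  apply: (mulfI z1'); rewrite mulrA divff// mul1r big_mkord.
  by rewrite -[in RHS](opprB (z ^+ n)) subrX1 -mulNr opprB.
apply: cvgc_sqmod0.
apply: (cvg_trans _ (cvg_geometric_sqmod (sqmod (1 - z)^-1) (q := sqmod z) _)).
  apply: near_eq_cvg; apply: nearW => n.
  by rewrite E mulrBr mulr1 addrAC subrr add0r sqmodN sqmodM sqmodX.
by rewrite sqmod_ge0 sqmod_lt1.
Qed.

(** Boundedness of the partial sums is equivalent to the convergence of the
    series in the definition of the Hardy space and is easier to transport. *)
Definition taylor a F : Prop :=
  (exists K, forall N, \sum_(0 <= k < N) sqmod (a k) <= K) /\
  forall z, `|z| < 1 -> \sum_(0 <= k < N) a k * z ^+ k @[N --> \oo] --> (F z : C^o).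

Definition radial F : Prop :=
  forall t : R, F (r%:C%C * expi t) @[r --> (1 : R)^'-] --> (F (expi t) : C^o).

Definition H2_series a F u : Prop :=
  [/\ cmeasurable u, taylor a F & boundary_value F u].

Lemma sqsum_bounded a : (exists K, forall N, \sum_(0 <= k < N) sqmod (a k) <= K) <->
  cvgn (series (fun k => sqmod (a k))).
Proof.
split=> [[K aK]|].
  apply: nondecreasing_is_cvgn.
    exact/nondecreasing_series/(fun k _ _ => sqmod_ge0 (a k)).
  by exists K => _ [N _ <-]; exact: aK.
move=> /cvg_seq_bounded[K [_ aK]]; exists (`|K| + 1) => N.
apply: le_trans (ler_norm _) _; apply: (aK _ _ N) => //.
by rewrite ltr_pwDr// ler_norm.
Qed.

Lemma hardy_diskP F : hardy_disk F <-> exists a, taylor a F.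
Proof.
by split=> -[a [h1 h2]]; exists a; split=> //; exact/sqsum_bounded.
Qed.

Lemma norm_disk (r t : R) : 0 <= r < 1 -> `|r%:C%C * expi t| < 1.
Proof.
by move=> /andP[r0 r1]; rewrite normrM norm_expi mulr1 ger0_norm ?ler0c// ltcR.
Qed.

Lemma cvg_left1 : (fun n : nat => 1 - n.+1%:R^-1 : R) @ \oo --> (1 : R)^'-.
Proof.
have h : (fun n : nat => 1 - n.+1%:R^-1 : R) @ \oo --> (1 : R).
  rewrite -[X in _ --> X]subr0; apply: cvgB; first exact: cvg_cst.
  exact: cvg_harmonic.
move=> P nP.
have hP : \forall n \near \oo, (1 - n.+1%:R^-1 < 1 :> R) -> P (1 - n.+1%:R^-1).
  exact: (h (fun x => x < 1 -> P x) nP).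
suff : \forall n \near \oo, P (1 - n.+1%:R^-1) by [].
by apply: filterS hP => n; apply; rewrite ltrBlDr ltrDl invr_gt0.
Qed.

(** Fatou's lemma bounds the energy of the boundary function, first along the
    partial sums on a circle of radius [r < 1], whose energy is a partial sum of
    square moduli by orthogonality, then along radii tending to 1. *)
Lemma H2_energy a F u K : cmeasurable u ->
  (forall N, \sum_(0 <= k < N) sqmod (a k) <= K) ->
  (forall z, `|z| < 1 -> \sum_(0 <= k < N) a k * z ^+ k @[N --> \oo] --> (F z : C^o)) ->
  boundary_value F u -> L2 u /\ L2norm u ^+ 2 <= K.
Proof.
move=> mu1 aK aF Fu; apply: L2_le_integral => //.
have inside (r : R) : 0 <= r < 1 -> cmeasurable (fun t => F (r%:C%C * expi t)) /\
    (\int[mu]_(t in D) (sqmod (F (r%:C%C * expi t)))%:E <= (2 * pi * K)%:E)%E.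
  move=> r01; pose S := trig_sum (fun k => a k * r%:C%C ^+ k).
  have SF t : S n t @[n --> \oo] --> (F (r%:C%C * expi t) : C^o).
    apply: cvg_trans (aF _ (norm_disk t r01)); apply: near_eq_cvg; apply: nearW => n.
    by apply: eq_bigr => k _; rewrite exprMn mulrA.
  have mS n : cmeasurable (S n) by apply: L2_cmeasurable; exact: L2_trig_sum.
  have mF : cmeasurable (fun t => F (r%:C%C * expi t)) by exact: cmeasurable_cvg SF.
  split=> //; apply: (fatou_sqmod mS mF); last by apply: aeW => t _; exact: SF.
  move=> n; rewrite integral_sqmod; last exact: L2_trig_sum.
  rewrite lee_fin ler_pM2l ?twopi_gt0// L2norm_trig_sum; apply: le_trans (aK n).
  apply: ler_sum => k _; rewrite sqmodM ler_piMr ?sqmod_ge0// sqmodX.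
  have [r0 r1] := andP r01; apply: exprn_ile1; first exact: sqmod_ge0.
  by rewrite /sqmod /= expr0n addr0 exprn_ile1// ltW.
have rn01 n : 0 <= 1 - n.+1%:R^-1 :> R.
  by rewrite subr_ge0 invf_le1 ?ltr0n ?ler1n.
have {}inside n : cmeasurable (fun t => F ((1 - n.+1%:R^-1 : R)%:C%C * expi t)) /\
    (\int[mu]_(t in D) (sqmod (F ((1 - n.+1%:R^-1 : R)%:C%C * expi t)))%:E
      <= (2 * pi * K)%:E)%E.
  by apply: inside; rewrite rn01 ltrBlDr ltrDl invr_gt0 ltr0n.
apply: (fatou_sqmod (fun n => (inside n).1) mu1 (fun n => (inside n).2)).
move: Fu; apply: circle_aeS => t h Dt; have := h Dt.
by apply: cvg_comp; exact: cvg_left1.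
Qed.

Lemma H2_series_L2 a F u : H2_series a F u -> L2 u.
Proof. by move=> [mu1 [[K aK] aF] Fu]; case: (H2_energy mu1 aK aF Fu). Qed.

Lemma H2_seriesP u : H2 u <-> exists a F, H2_series a F u.
Proof.
split=> [[u2 [F [/hardy_diskP[a aF] Fu]]]|[a [F h]]].
  by exists a, F; split=> //; exact: L2_cmeasurable.
split; first exact: H2_series_L2 h.
by case: h => _ aF Fu; exists F; split=> //; apply/hardy_diskP; exists a.
Qed.

Lemma cvg_real_complex : (r%:C%C : C) @[r --> (1 : R)^'-] --> ((1 : C) : C^o).
Proof.
apply: cvgc_sqmod0; have h : r - 1 @[r --> (1 : R)^'-] --> (1 - 1 : R).
  have h1 : r @[r --> (1 : R)^'-] --> (1 : R) by apply: cvg_at_left_filter; exact: cvg_id.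
  have h2 : (1 : R) @[_ --> (1 : R)^'-] --> (1 : R) by exact: cvg_cst.
  exact: cvgB h1 h2.
have E : (fun r : R => sqmod (r%:C%C - 1)) = (fun r : R => (r - 1) * (r - 1)).
  by apply/funext => r; rewrite /sqmod /= subr0 expr0n addr0 expr2.
have E0 : (1 - 1) * (1 - 1) = 0 :> R by rewrite subrr mulr0.
by rewrite E -E0; exact: (cvgM h h).
Qed.

Lemma radial_id : radial id.
Proof.
move=> t; rewrite -[X in _ --> X]mul1r.
have h : (expi t : C) @[_ --> (1 : R)^'-] --> (expi t : C^o) by exact: (@cvg_cst C^o).
exact: (cvgM cvg_real_complex h).
Qed.

Lemma radial_cst c : radial (fun=> c).
Proof. by move=> t; exact: (@cvg_cst C^o). Qed.

Lemma radialD F G : radial F -> radial G -> radial (fun z => F z + G z).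
Proof. by move=> hF hG t; exact: (@cvgD _ C^o _ _ _ _ _ _ _ (hF t) (hG t)). Qed.

Lemma radialM F G : radial F -> radial G -> radial (fun z => F z * G z).
Proof. by move=> hF hG t; exact: (cvgM (hF t) (hG t)). Qed.

Lemma radialV F : radial F -> (forall t, F (expi t) != 0) -> radial (fun z => (F z)^-1).
Proof. by move=> hF F0 t; exact: (cvgV (F0 t) (hF t)). Qed.

Lemma disk_denom_neq0 c z : `|c| < 1 -> `|z| <= 1 -> 1 - c * z != 0.
Proof.
move=> c1 z1; apply: contraTneq c1 => /eqP; rewrite subr_eq0 => /eqP h.
have : `|c * z| = 1 by rewrite -h normr1.
rewrite normrM => <-; rewrite -real_leNgt ?realM ?normr_real//.
by rewrite ler_piMr.
Qed.

Definition cauchy c z : C := (1 - c * z)^-1.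

Lemma radial_cauchy c : `|c| < 1 -> radial (cauchy c).
Proof.
move=> c1; apply: radialV => [|t]; last by rewrite disk_denom_neq0 ?norm_expi.
apply: radialD; first exact: radial_cst.
have := radialM (@radial_cst (- c)) radial_id.
by under eq_fun do rewrite mulNr.
Qed.

Lemma cmeasurable_cauchy c : `|c| < 1 -> cmeasurable (on_circle (cauchy c)).
Proof.
move=> c1; apply: (@cmeasurable_cvg _ (trig_sum (fun k => c ^+ k))) => [n|t].
  by apply: L2_cmeasurable; exact: L2_trig_sum.
have := @cvgc_geometric (c * expi t); rewrite normrM norm_expi mulr1 => /(_ c1) h.
by apply: cvg_trans h; apply: near_eq_cvg; apply: nearW => n; apply: eq_bigr => k _; rewrite exprMn.
Qed.

Lemma boundary_valueM F u G : boundary_value F u -> radial G ->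
  boundary_value (fun z => F z * G z) (fun t => u t * on_circle G t).
Proof.
move=> Fu rG; move: Fu; apply: circle_aeS => t h Dt.
exact: (cvgM (h Dt) (rG t)).
Qed.

Lemma taylor_lin c a b F G : taylor a F -> taylor b G ->
  taylor (fun k => c * a k + b k) (fun z => c * F z + G z).
Proof.
move=> [[K aK] aF] [[L bL] bG]; split.
  exists (2 * (sqmod c * K) + 2 * L) => N.
  apply: le_trans (_ : \sum_(0 <= k < N) (2 * (sqmod c * sqmod (a k)) + 2 * sqmod (b k)) <= _).
    by apply: ler_sum => k _; rewrite -sqmodM sqmodD_le.
  rewrite big_split /= -!mulr_sumr; apply: lerD; last by rewrite ler_pM2l.
  by rewrite ler_pM2l//; apply: ler_wpM2l; [exact: sqmod_ge0|exact: aK].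
move=> z z1; under eq_fun do under eq_bigr do rewrite mulrDl -mulrA.
under eq_fun do rewrite big_split /= -mulr_sumr.
have hc : (c : C) @[_ --> \oo] --> (c : C^o) by exact: (@cvg_cst C^o).
exact: (@cvgD _ C^o _ _ _ _ _ _ _ (cvgM hc (aF z z1)) (bG z z1)).
Qed.

Lemma H2_series_lin c a b F G u v : H2_series a F u -> H2_series b G v ->
  H2_series (fun k => c * a k + b k) (fun z => c * F z + G z) (fun t => c * u t + v t).
Proof.
move=> [mu1 aF Fu] [mv bG Gv]; split.
- by apply: cmeasurableD => //; apply: cmeasurableM => //; exact: cmeasurable_cst.
- exact: taylor_lin.
- move: Fu Gv; apply: circle_aeS2 => t h1 h2 Dt.
  have hc : (c : C) @[_ --> (1 : R)^'-] --> (c : C^o) by exact: (@cvg_cst C^o).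
  exact: (@cvgD _ C^o _ _ _ _ _ _ _ (cvgM hc (h1 Dt)) (h2 Dt)).
Qed.

Lemma taylorMX a F : taylor a F ->
  taylor (fun k => if k is j.+1 then a j else 0) (fun z => F z * z).
Proof.
move=> [[K aK] aF]; split.
  exists K => -[|N]; first by have := aK 0%N; rewrite !big_geq.
  by rewrite big_nat_recl// sqmod0 add0r.
move=> z z1; rewrite -(@cvg_shiftS C^o) /=.
under eq_fun => N.
  rewrite big_nat_recl// mul0r add0r.
  rewrite (_ : \sum_(0 <= i < N) _ = (\sum_(0 <= i < N) a i * z ^+ i) * z); last first.
    by rewrite mulr_suml; apply: eq_bigr => i _; rewrite exprSr mulrA.
  over.
have hz : (z : C) @[_ --> \oo] --> (z : C^o) by exact: (@cvg_cst C^o).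
exact: (cvgM (aF z z1) hz).
Qed.

Lemma H2_seriesMX a F u : H2_series a F u ->
  H2_series (fun k => if k is j.+1 then a j else 0) (fun z => F z * z)
    (fun t => u t * expi t).
Proof.
move=> [mu1 aF Fu]; split.
- by apply: cmeasurableM => //; exact: cmeasurable_expi.
- exact: taylorMX.
- exact: (boundary_valueM Fu radial_id).
Qed.

(** Coefficients of the product with [1 / (1 - c z)], from the recurrence obtained
    by clearing the denominator. *)
Fixpoint cauchy_coef c a k : C :=
  if k is j.+1 then a j.+1 + c * cauchy_coef c a j else a 0%N.

(** Since [c] has modulus less than 1, the recurrence for the coefficients
    contracts, which bounds the sums of their square moduli. *)
Lemma taylorM_cauchy c a F : `|c| < 1 -> taylor a F ->
  taylor (cauchy_coef c a) (fun z => F z * cauchy c z).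
Proof.
move=> c1 [[K aK] aF]; pose g := cauchy_coef c a.
(* Any q strictly between the modulus of c and 1 works; the midpoint is taken so
   that q > 0 also when c = 0. *)
have [q [q0 q1 cq]] : exists q : R, [/\ 0 < q, q < 1 & sqmod c <= q ^+ 2].
  have s1 : Num.sqrt (sqmod c) < 1 by rewrite -sqrtr1 ltr_sqrt// sqmod_lt1.
  have s0 := sqrtr_ge0 (sqmod c).
  exists ((1 + Num.sqrt (sqmod c)) / 2); split; [lra|lra|].
  rewrite -[leLHS]sqr_sqrtr ?sqmod_ge0// ler_pXn2r ?nnegrE//; lra.
have q1' : 0 < 1 - q by rewrite subr_gt0.
(* Convexity of the square modulus, with weights 1 - q and q. *)
have step x y : sqmod (x + c * y) <= sqmod x / (1 - q) + q * sqmod y.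
  have h1 : sqmod (x + c * y) <= sqmod x / (1 - q) + sqmod (c * y) / q.
    rewrite -subr_ge0 -(pmulr_rge0 _ (mulr_gt0 q0 q1')).
    rewrite [X in 0 <= X](_ : _ = sqmod (q%:C%C * x - (1 - q)%:C%C * (c * y))) ?sqmod_ge0//.
    move: (c * y) => w; case: x w => x1 x2 [w1 w2]; rewrite /sqmod/=.
    by field; rewrite !gt_eqF.
  apply: le_trans h1 _; rewrite lerD2l ler_pdivrMr// sqmodM mulrAC -expr2.
  by apply: ler_wpM2r; rewrite ?sqmod_ge0.
have g_sum N : \sum_(0 <= k < N.+1) sqmod (g k) <=
    \sum_(0 <= k < N.+1) sqmod (a k) / (1 - q) + q * \sum_(0 <= k < N) sqmod (g k).
  elim: N => [|N IH].
    rewrite !big_nat1 big_geq// mulr0 addr0 ler_pdivlMr// ler_piMr ?sqmod_ge0//.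
    by rewrite gerBl ltW.
  rewrite big_nat_recr//= (big_nat_recr N.+1)//= [X in q * X]big_nat_recr//= mulrDr addrACA.
  by apply: lerD => //; exact: step.
have gK N : \sum_(0 <= k < N) sqmod (g k) <= K / (1 - q) / (1 - q).
  rewrite ler_pdivlMr//.
  have le_recr : \sum_(0 <= k < N) sqmod (g k) <= \sum_(0 <= k < N.+1) sqmod (g k).
    by rewrite [leRHS]big_nat_recr//= lerDl sqmod_ge0.
  have := le_trans le_recr (g_sum N); rewrite -mulr_suml => h.
  have : (\sum_(0 <= k < N.+1) sqmod (a k)) / (1 - q) <= K / (1 - q).
    by rewrite ler_pM2r ?invr_gt0.
  by move: h; lra.
split; first by exists (K / (1 - q) / (1 - q)).
move=> z z1; have d0 := disk_denom_neq0 c1 (ltW z1).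
have E N : \sum_(0 <= k < N.+1) g k * z ^+ k =
    (\sum_(0 <= k < N.+1) a k * z ^+ k - c * z * (g N * z ^+ N)) * cauchy c z.
  apply: (canRL (mulfK d0)); elim: N => [|N IH].
    by rewrite !big_nat1 !expr0 /g/=; ring.
  rewrite big_nat_recr//= mulrDl IH [in RHS]big_nat_recr//= /g/= exprS; ring.
rewrite -(@cvg_shiftS C^o) /=; under eq_fun do rewrite E.
have hF : \sum_(0 <= k < N.+1) a k * z ^+ k @[N --> \oo] --> (F z : C^o).
  by rewrite (@cvg_shiftS C^o (fun N => \sum_(0 <= k < N) a k * z ^+ k)); exact: aF.
have hc : (cauchy c z : C) @[_ --> \oo] --> (cauchy c z : C^o) by exact: (@cvg_cst C^o).
have hcz : (c * z : C) @[_ --> \oo] --> (c * z : C^o) by exact: (@cvg_cst C^o).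
suff hg : g N * z ^+ N @[N --> \oo] --> (0 : C^o).
  have hh : (\sum_(0 <= k < N.+1) a k * z ^+ k - c * z * (g N * z ^+ N))
      @[N --> \oo] --> (F z : C^o).
    have -> : F z = F z - c * z * 0 by rewrite mulr0 subr0.
    exact: (@cvgB _ C^o _ _ _ _ _ _ _ hF (cvgM hcz hg)).
  exact: (cvgM hh hc).
apply: cvgc_sqmod0; pose L := K / (1 - q) / (1 - q).
have hL : L * sqmod z ^+ n @[n --> \oo] --> 0.
  by apply: cvg_geometric_sqmod; rewrite sqmod_ge0 sqmod_lt1.
apply: (@squeeze_cvgr _ _ _ _ (fun=> 0) (fun n => L * sqmod z ^+ n)); [|exact: cvg_cst|exact: hL].
apply: nearW => n; rewrite subr0 sqmod_ge0 sqmodM sqmodX.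
apply: ler_wpM2r; first by rewrite exprn_ge0// sqmod_ge0.
apply: le_trans (gK n.+1); rewrite big_nat_recr//= lerDr sumr_ge0// => k _.
exact: sqmod_ge0.
Qed.

End HardySpace.

(** * Fourier expansion and reproducing property *)

Section HardyExpansion.
Variable R : realType.
Local Notation C := R[i].
Local Notation mu := (@lebesgue_measure R).
Local Notation D := (`[0, 2 * pi]%classic : set R).
Implicit Types (a b : nat -> C) (F G : C -> C) (u v w : R -> C) (c z : C).

Lemma H2_series_ext a b F G u v : a =1 b -> F =1 G -> u =1 v ->
  H2_series a F u -> H2_series b G v.
Proof. by move=> /funext-> /funext-> /funext->. Qed.

Lemma circle_sub_neq0 c (t : R) : `|c| < 1 -> expi t - c != 0.
Proof.
move=> c1; apply: contraTneq c1 => /eqP; rewrite subr_eq0 => /eqP <-.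
by rewrite norm_expi ltxx.
Qed.

Lemma circle_cauchyJ c (t : R) : `|c| < 1 ->
  (cauchy c^* (expi t))^* = expi t / (expi t - c).
Proof.
move=> c1; have h := circle_sub_neq0 t c1; have h1 := expi_unit t.
rewrite /cauchy fmorphV rmorphB rmorph1 rmorphM /= conjCK conj_expi.
by field; rewrite h h1.
Qed.

(** [F] is the holomorphic function in the disk and [u] its boundary function;
    both are kept because the first is evaluated at points of the disk while the
    second is integrated. *)
Definition in_H2 F u : Prop := exists a, H2_series a F u.

Lemma in_H2_ext F G u v : F =1 G -> u =1 v -> in_H2 F u -> in_H2 G v.
Proof. by move=> /funext-> /funext->. Qed.

Lemma H2_series1 : H2_series (fun k => (k == 0%N)%:R : C) (fun=> 1) (fun=> 1).
Proof.
split; first exact: cmeasurable_cst.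
  split.
    exists 1 => -[|N]; first by rewrite big_geq.
    rewrite big_nat_recl// eqxx sqmod1 big1 ?addr0// => k _.
    by rewrite sqmod0.
  move=> z _; rewrite -(@cvg_shiftS C^o) /=; under eq_fun => N.
    rewrite big_nat_recl//= expr0 mulr1 big1 ?addr0; last by move=> k _; rewrite mul0r.
    over.
  exact: (@cvg_cst C^o).
by apply: aeW => t _; exact: (@cvg_cst C^o).
Qed.

Lemma H2_seriesX n : H2_series (fun k => (k == n)%:R : C) (fun z => z ^+ n)
  (fun t => expi t ^+ n).
Proof.
elim: n => [|n IH]; first exact: H2_series1.
apply: H2_series_ext (H2_seriesMX IH) => [[]//|z|t]; by rewrite exprSr.
Qed.

Lemma H2_series0 : H2_series (fun=> 0 : C) (fun=> 0) (fun=> 0).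
Proof.
by apply: H2_series_ext (H2_series_lin (-1) H2_series1 H2_series1) => ?;
  rewrite mulN1r addNr.
Qed.

Lemma H2_series_trig_sum a N : H2_series (fun k => if (k < N)%N then a k else 0)
  (fun z => \sum_(0 <= k < N) a k * z ^+ k) (trig_sum a N).
Proof.
elim: N => [|N IH].
  by apply: H2_series_ext H2_series0 => x; rewrite /trig_sum ?big_geq.
apply: H2_series_ext (H2_series_lin (a N) (H2_seriesX N) IH) => x.
- rewrite [in RHS]ltnS [in RHS]leq_eqVlt; case: eqP => [->|_]; first by rewrite ltnn mulr1 addr0.
  by rewrite mulr0 add0r.
- by rewrite big_nat_recr//= addrC.
- by rewrite /trig_sum big_nat_recr//= addrC.
Qed.

(** The remainder after [N] terms is itself a boundary function, of a series
    with the first [N] coefficients removed, so its energy is at most the tail of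
    the series of square moduli and the expansion may be integrated termwise. *)
Lemma H2_inner_cvg a F u v : H2_series a F u -> L2 v ->
  \sum_(0 <= k < N) a k * inner (fun t => expi t ^+ k) v @[N --> \oo]
    --> (inner u v : C^o).
Proof.
move=> /[dup] Hu [mu1 [aK aF] Fu] v2.
have u2 := H2_series_L2 Hu.
have /sqsum_bounded cs := aK; set T := limn (series (fun k => sqmod (a k))) in cs.
have sT N : \sum_(0 <= k < N) sqmod (a k) <= T.
  apply: (@nondecreasing_cvgn_le _ (series (fun k => sqmod (a k)))) => //.
  by apply: nondecreasing_series => k _ _; exact: sqmod_ge0.
have tail N : L2norm (fun t => u t - trig_sum a N t) ^+ 2 <=
    T - \sum_(0 <= k < N) sqmod (a k).
  have [m1 [_ h2] h3] := H2_series_lin (-1) (H2_series_trig_sum a N) Hu.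
  have := H2_energy m1 _ h2 h3.
  move=> /(_ (T - \sum_(0 <= k < N) sqmod (a k)))[M|_].
    apply: le_trans (_ : \sum_(0 <= k < N + M)
      sqmod (-1 * (if (k < N)%N then a k else 0) + a k) <= _).
      rewrite [leRHS](@big_cat_nat _ _ _ M)//= ?leq_addl// lerDl sumr_ge0// => k _.
      exact: sqmod_ge0.
    rewrite lerBrDr (@big_cat_nat _ _ _ N)//= ?leq_addr//.
    rewrite big_nat_cond big1 ?add0r; last first.
      by move=> k /andP[/andP[_ ->] _]; rewrite mulN1r addNr sqmod0.
    apply: le_trans (sT (N + M)%N); rewrite addrC [leRHS](@big_cat_nat _ _ _ N)//= ?leq_addr//.
    rewrite lerD2l big_nat_cond [leRHS]big_nat_cond.
    apply: ler_sum => k /andP[/andP[Nk _] _].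
    by rewrite ltnNge Nk /= mulr0 add0r.
  by under eq_fun do rewrite mulN1r addrC.
apply: cvgc_sqmod0.
have lim0 : (T - \sum_(0 <= k < N) sqmod (a k)) * L2norm v ^+ 2 @[N --> \oo] --> 0.
  have h1 : (T - \sum_(0 <= k < N) sqmod (a k)) @[N --> \oo] --> (T - T).
    have hT : T @[_ --> \oo] --> T by exact: cvg_cst.
    exact: cvgB hT cs.
  have hv : L2norm v ^+ 2 @[_ --> \oo] --> L2norm v ^+ 2 by exact: cvg_cst.
  have E0 : (T - T) * L2norm v ^+ 2 = 0 by rewrite subrr mul0r.
  by rewrite -[X in _ --> X]E0; exact: (cvgM h1 hv).
apply: (@squeeze_cvgr _ _ _ _ (fun=> 0)
  (fun N => (T - \sum_(0 <= k < N) sqmod (a k)) * L2norm v ^+ 2));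
  [|exact: cvg_cst|exact: lim0].
apply: nearW => N; rewrite sqmod_ge0 -inner_trig_sum// -sqmodN opprB.
rewrite -innerBl//=; last exact: L2_trig_sum.
apply: le_trans (Cauchy_Schwarz _ v2) _; first by apply: L2B => //; exact: L2_trig_sum.
by apply: ler_wpM2r; [exact: sqr_ge0|exact: tail].
Qed.

Lemma H2_coef a F u j : H2_series a F u -> inner u (fun t => expi t ^+ j) = a j.
Proof.
move=> Hu; have h := H2_inner_cvg Hu (L2_expi R j).
suff h2 : \sum_(0 <= k < N) a k * inner (fun t => expi t ^+ k) (fun t => expi t ^+ j)
    @[N --> \oo] --> (a j : C^o) by exact: (@cvg_unique C^o _ _ _ _ _ h h2).
rewrite -(@cvg_shiftn j.+1 C^o) /=; under eq_fun => N.
  rewrite -inner_trig_sum ?inner_trig_sum_expi//;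
    [|by rewrite addnS ltnS leq_addl|exact: L2_expi].
  over.
exact: (@cvg_cst C^o).
Qed.

(** The difference of the two boundary functions comes from the zero series,
    whose energy bound is 0. *)
Lemma H2_series_eq a F G u v : H2_series a F u -> H2_series a G v -> eq_circle u v.
Proof.
move=> Hu Hv; have Hd := H2_series_lin (-1) Hv Hu.
have [m1 [_ h2] h3] := Hd.
have aK N : \sum_(0 <= k < N) sqmod (-1 * a k + a k) <= 0.
  by rewrite big1// => k _; rewrite mulN1r addNr sqmod0.
have [d2 d0] := H2_energy m1 aK h2 h3.
have /(L2norm0_eq_circle d2) : L2norm (fun t => -1 * v t + u t) = 0.
  by apply/eqP; rewrite -sqrf_eq0 eq_le d0 sqr_ge0.
apply: circle_aeS => t h Dt; have /eqP := h Dt.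
by rewrite mulN1r addrC subr_eq0 => /eqP.
Qed.

Lemma H2_series_cauchy c : `|c| < 1 ->
  H2_series (fun k => c ^+ k) (cauchy c) (on_circle (cauchy c)).
Proof.
move=> c1; split; first exact: cmeasurable_cauchy.
  split; last first.
    move=> z z1; under eq_fun do under eq_bigr do rewrite -exprMn.
    apply: cvgc_geometric; rewrite normrM; apply: le_lt_trans z1.
    by rewrite ler_piMl// ltW.
  exists (1 - sqmod c)^-1 => N; have q1 := sqmod_lt1 c1.
  rewrite -[leRHS]mul1r ler_pdivlMr ?subr_gt0//.
  under eq_bigr do rewrite sqmodX.
  rewrite big_mkord mulrC -opprB mulNr -subrX1 opprB lerBlDr lerDl exprn_ge0//.
  exact: sqmod_ge0.
by apply: aeW => t _; exact: radial_cauchy.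
Qed.

(** The Fourier coefficients of [cauchy c^*] are the conjugates of the powers of
    [c], so the expansion of the inner product is the Taylor series at [c]. *)
Lemma H2_reproducing a F u c : H2_series a F u -> `|c| < 1 ->
  inner u (on_circle (cauchy c^*)) = F c.
Proof.
move=> Hu c1; have c1' : `|c^*| < 1 by rewrite norm_conjC.
have Hk := H2_series_cauchy c1'; have k2 := H2_series_L2 Hk.
have h1 := H2_inner_cvg Hu k2; have [_ [_ /(_ _ c1) h2] _] := Hu.
suff h3 : \sum_(0 <= k < N) a k * inner (fun t => expi t ^+ k) (on_circle (cauchy c^*))
    @[N --> \oo] --> (F c : C^o) by exact: (@cvg_unique C^o _ _ _ _ _ h1 h3).
rewrite (_ : (fun N => _) = fun N => \sum_(0 <= k < N) a k * c ^+ k)//.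
apply/funext => N; apply: eq_bigr => k _; rewrite inner_conj//; last exact: L2_expi.
by rewrite (H2_coef k Hk) rmorphXn /= conjCK.
Qed.

Lemma in_H2_L2 F u : in_H2 F u -> L2 u.
Proof. by case=> a; exact: H2_series_L2. Qed.

Lemma H2P u : H2 u <-> exists F, in_H2 F u.
Proof.
split=> [/H2_seriesP[a [F h]]|[F [a h]]]; first by exists F, a.
by apply/H2_seriesP; exists a, F.
Qed.

Lemma in_H2_lin c F G u v : in_H2 F u -> in_H2 G v ->
  in_H2 (fun z => c * F z + G z) (fun t => c * u t + v t).
Proof. by move=> [a Hu] [b Hv]; eexists; exact: H2_series_lin Hu Hv. Qed.

Lemma in_H2_0 : in_H2 (fun=> 0) (fun=> 0).
Proof. by eexists; exact: H2_series0. Qed.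

Lemma in_H2_1 : in_H2 (fun=> 1) (fun=> 1).
Proof. by eexists; exact: H2_series1. Qed.

Lemma in_H2Z c F u : in_H2 F u -> in_H2 (fun z => c * F z) (fun t => c * u t).
Proof.
by move=> Hu; apply: in_H2_ext (in_H2_lin c Hu in_H2_0) => ?; rewrite addr0.
Qed.

Lemma H2_series_sum (I : Type) (s : seq I) (x : I -> C) (b : I -> nat -> C)
    (G : I -> C -> C) (g : I -> R -> C) :
  (forall i, H2_series (b i) (G i) (g i)) ->
  H2_series (fun k => \sum_(i <- s) x i * b i k) (fun z => \sum_(i <- s) x i * G i z)
    (fun t => \sum_(i <- s) x i * g i t).
Proof.
move=> Gg; elim: s => [|i s IH].
  by apply: H2_series_ext H2_series0 => ?; rewrite big_nil.
by apply: H2_series_ext (H2_series_lin (x i) (Gg i) IH) => ?; rewrite big_cons.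
Qed.

Lemma in_H2_sum (I : Type) (s : seq I) (x : I -> C) (G : I -> C -> C) (g : I -> R -> C) :
  (forall i, in_H2 (G i) (g i)) ->
  in_H2 (fun z => \sum_(i <- s) x i * G i z) (fun t => \sum_(i <- s) x i * g i t).
Proof.
by move=> /choice[b Hb]; exists (fun k => \sum_(i <- s) x i * b i k); exact: H2_series_sum.
Qed.

Lemma in_H2MX F u : in_H2 F u -> in_H2 (fun z => F z * z) (fun t => u t * expi t).
Proof. by move=> [a Hu]; eexists; exact: H2_seriesMX Hu. Qed.

Lemma in_H2M_cauchy c F u : `|c| < 1 -> in_H2 F u ->
  in_H2 (fun z => F z * cauchy c z) (fun t => u t * on_circle (cauchy c) t).
Proof.
move=> c1 [a [mu1 aF Fu]]; exists (cauchy_coef c a); split.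
- by apply: cmeasurableM => //; exact: cmeasurable_cauchy.
- exact: taylorM_cauchy.
- by apply: boundary_valueM => //; exact: radial_cauchy.
Qed.

Lemma in_H2_cauchy c : `|c| < 1 -> in_H2 (cauchy c) (on_circle (cauchy c)).
Proof. by move=> c1; eexists; exact: H2_series_cauchy. Qed.

Lemma in_H2_eval F u c : in_H2 F u -> `|c| < 1 -> inner u (on_circle (cauchy c^*)) = F c.
Proof. by move=> [a Hu]; exact: H2_reproducing Hu. Qed.

Lemma in_H2_mean F u : in_H2 F u -> circle_mean u = F 0.
Proof.
move=> Hu; rewrite -(in_H2_eval (c := 0) Hu) ?normr0// /inner; congr circle_mean.
apply/funext => t; rewrite /on_circle /cauchy.
by rewrite conjC0 mul0r subr0 invr1 conjC1 mulr1.
Qed.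

Definition blaschke_factor c z : C := (c - z) / (1 - c^* * z).

Lemma in_H2M_blaschke_factor c F u : `|c| < 1 -> in_H2 F u ->
  in_H2 (fun z => F z * blaschke_factor c z)
    (fun t => u t * on_circle (blaschke_factor c) t).
Proof.
move=> c1 Hu; have c1' : `|c^*| < 1 by rewrite norm_conjC.
apply: in_H2_ext (in_H2M_cauchy c1' (in_H2_lin c Hu (in_H2Z (-1) (in_H2MX Hu)))) => x;
  rewrite /on_circle /cauchy /blaschke_factor; ring.
Qed.

Lemma in_H2M_blaschke_prod (I : Type) (s : seq I) (P : pred I) (x : I -> C) F u :
  (forall i, `|x i| < 1) -> in_H2 F u ->
  in_H2 (fun z => F z * \prod_(i <- s | P i) blaschke_factor (x i) z)
    (fun t => u t * \prod_(i <- s | P i) blaschke_factor (x i) (expi t)).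
Proof.
move=> x1 Hu; elim: s => [|i s IH].
  by apply: in_H2_ext Hu => ?; rewrite big_nil mulr1.
case: (boolP (P i)) => Pi.
  by apply: in_H2_ext (in_H2M_blaschke_factor (x1 i) IH) => ?;
    rewrite big_cons Pi mulrAC -mulrA.
by apply: in_H2_ext IH => ?; rewrite big_cons (negbTE Pi).
Qed.

Lemma in_H2_horner (p : {poly C}) : in_H2 (horner p) (on_circle (horner p)).
Proof.
have Xi (i : 'I_(size p)) : in_H2 (fun z : C => z ^+ i) (fun t => expi t ^+ i).
  by eexists; exact: H2_seriesX.
by apply: in_H2_ext (in_H2_sum (index_enum _) (fun i : 'I_(size p) => p`_i) Xi) => x;
  rewrite /on_circle horner_coef.
Qed.

End HardyExpansion.

(** * Model spaces of finite Blaschke products with distinct zeros *)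

Section BlaschkeModel.
Variable R : realType.
Local Notation C := R[i].
Local Notation mu := (@lebesgue_measure R).
Local Notation D := (`[0, 2 * pi]%classic : set R).
Variables (k : nat) (a : 'I_k -> C).
Hypothesis a_disk : forall i, `|a i| < 1.
Hypothesis a_inj : injective a.
Implicit Types (F G : C -> C) (u v f h : R -> C) (c z : C).

Local Notation theta := (blaschke a).

(** At a zero of [theta] the reproducing kernel of the model space reduces to the
    Cauchy kernel. *)
Definition szego (p : 'I_k) : C -> C := cauchy (a p)^*.

(** The function [theta z / (z - a p)], written without its removable
    singularity: the conjugate kernel of the model space at [a p]. *)
Definition dual_kernel (p : 'I_k) z : C :=
  - cauchy (a p)^* z * \prod_(i < k | i != p) blaschke_factor (a i) z.

Let a_diskJ p : `|(a p)^*| < 1.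
Proof. by rewrite norm_conjC. Qed.

Lemma blaschke_dual p z : (z - a p) * dual_kernel p z = theta z.
Proof.
rewrite /blaschke (bigD1 p)//= /dual_kernel /cauchy mulrA; congr (_ * _).
by rewrite mulrN -mulNr opprB.
Qed.

Lemma blaschke_root p : theta (a p) = 0.
Proof. by rewrite -(blaschke_dual p) subrr mul0r. Qed.

Lemma kernel_szego p : Defs.kernel theta (a p) = szego p.
Proof.
by apply/funext => z; rewrite /Defs.kernel blaschke_root conjC0 mul0r subr0 mul1r.
Qed.

Lemma dual_kernel_root s t : s != t -> dual_kernel t (a s) = 0.
Proof.
move=> st; have := blaschke_dual t (a s); rewrite blaschke_root => /eqP.
by rewrite mulf_eq0 subr_eq0 (inj_eq a_inj) (negbTE st) => /eqP.
Qed.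

Lemma dual_kernel_neq0 t : dual_kernel t (a t) != 0.
Proof.
have d0 p : 1 - (a p)^* * a t != 0 by rewrite disk_denom_neq0// ltW.
rewrite mulf_neq0 ?oppr_eq0 ?invr_neq0//; apply/prodf_neq0 => i it.
by rewrite mulf_neq0 ?invr_neq0// subr_eq0 (inj_eq a_inj).
Qed.

Lemma cvg_dual_kernel p (T : Type) (Fl : set_system T) {FF : Filter Fl} (Z : T -> C) z :
  `|z| <= 1 -> Z x @[x --> Fl] --> (z : C^o) ->
  dual_kernel p (Z x) @[x --> Fl] --> (dual_kernel p z : C^o).
Proof.
move=> z1 Zz.
have cC (x : C) : x @[_ --> Fl] --> (x : C^o) by exact: (@cvg_cst C^o).
have cau (d : C) : `|d| < 1 -> cauchy d (Z h) @[h --> Fl] --> (cauchy d z : C^o).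
  move=> d1; apply: cvgV; first by rewrite disk_denom_neq0.
  exact: (@cvgB _ C^o _ _ _ _ _ _ _ (cC 1) (cvgM (cC d) Zz)).
apply: cvgM; first exact: (@cvgN _ C^o _ _ _ _ _ (cau _ (a_diskJ p))).
elim: (index_enum _) => [|i s IH].
  by rewrite big_nil; under eq_fun do rewrite big_nil; exact: cC.
rewrite big_cons; under eq_fun do rewrite big_cons.
case: (i != p); last exact: IH.
exact: (cvgM (cvgM (@cvgB _ C^o _ _ _ _ _ _ _ (cC (a i)) Zz) (cau _ (a_diskJ i))) IH).
Qed.

(** With [theta z = (z - a t) * dual_kernel t z], the difference quotient of
    [theta] at [a t] is the value of the dual kernel nearby. *)
Lemma blaschke_cderiv t : cderiv theta (a t) = dual_kernel t (a t).
Proof.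
rewrite /cderiv /derive1; apply: (@cvg_lim C^o) => //.
have hshift : h + a t @[h --> (0 : C^o)^'] --> (a t : C^o).
  have h0 : (fun h : C^o => h) @ (0 : C^o)^' --> (0 : C^o) by exact: cvg_within.
  have hc : a t @[_ --> (0 : C^o)^'] --> (a t : C^o) by exact: (@cvg_cst C^o).
  by rewrite -[X in _ --> X]add0r; exact: (@cvgD _ C^o _ _ _ _ _ _ _ h0 hc).
apply: cvg_trans (@cvg_dual_kernel t _ _ _ _ _ (ltW (a_disk t)) hshift).
apply: near_eq_cvg; near=> h.
have h0 : h != 0 by near: h; exact: nbhs_dnbhs_neq.
rewrite blaschke_root subr0 -(blaschke_dual t) addrK.
by rewrite -[RHS]/(h^-1 * (h * _)) mulrA mulVf// mul1r.
Unshelve. all: by end_near. Qed.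

(** Conjugation with respect to [theta] exchanges, up to the factor [z], the
    kernels and the dual kernels; the two identities below on the unit circle
    carry most of the computations with these functions. *)
Lemma circle_szegoJ_blaschke p t :
  (szego p (expi t))^* * theta (expi t) = expi t * dual_kernel p (expi t).
Proof.
rewrite /szego circle_cauchyJ// -(blaschke_dual p).
by have h := circle_sub_neq0 t (a_disk p); field.
Qed.

Lemma circle_blaschke_unit t : theta (expi t) * (theta (expi t))^* = 1.
Proof.
rewrite /blaschke rmorph_prod -big_split big1// => i _ /=.
rewrite fmorph_div !rmorphB rmorph1 rmorphM /= conjCK conj_expi.
have h1 := expi_unit t; have h2 := circle_sub_neq0 t (a_disk i).
have h3 : 1 - (a i)^* * expi t != 0 by rewrite disk_denom_neq0// norm_expi.
have h4 : a i - expi t != 0 by rewrite -opprB oppr_eq0.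
have -> : (a i)^* - (expi t)^-1 = - (1 - (a i)^* * expi t) / expi t by field.
have -> : 1 - a i * (expi t)^-1 = - (a i - expi t) / expi t by field.
by field; rewrite h1 h3 h4.
Qed.

Lemma circle_dualJ_blaschke p t :
  (dual_kernel p (expi t))^* * theta (expi t) = expi t * szego p (expi t).
Proof.
have e3 : szego p (expi t) * (theta (expi t))^* =
    (expi t)^-1 * (dual_kernel p (expi t))^*.
  rewrite -conj_expi -[RHS](rmorphM Num.conj) -circle_szegoJ_blaschke.
  by rewrite [RHS](rmorphM Num.conj); congr (_ * _); exact/esym/conjCK.
apply: (mulfI (invr_neq0 (expi_unit t))); rewrite mulrA -e3 -mulrA [_^* * _]mulrC.
by rewrite circle_blaschke_unit mulr1 mulKf// expi_unit.
Qed.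

Lemma in_H2_szego p : in_H2 (szego p) (on_circle (szego p)).
Proof. exact: in_H2_cauchy. Qed.

Lemma in_H2_dual_kernel p : in_H2 (dual_kernel p) (on_circle (dual_kernel p)).
Proof.
have h := in_H2Z (-1) (in_H2_szego p).
have := in_H2M_blaschke_prod (index_enum _) (fun i => i != p) a_disk h.
by apply: in_H2_ext => ?; rewrite mulN1r.
Qed.

Lemma in_H2M_blaschke F u : in_H2 F u ->
  in_H2 (fun z => F z * theta z) (fun t => u t * on_circle theta t).
Proof. exact: in_H2M_blaschke_prod. Qed.

Lemma in_H2_blaschkeM F h : in_H2 F h ->
  in_H2 (fun z => F z * theta z) (fun t => on_circle theta t * h t).
Proof. by move=> /in_H2M_blaschke; apply: in_H2_ext => // t; rewrite mulrC. Qed.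

Lemma H2M_blaschke h : H2 h -> H2 (fun t => on_circle theta t * h t).
Proof.
move=> /H2P[F Fh]; apply/H2P; exists (fun z => F z * theta z).
exact: in_H2_blaschkeM.
Qed.

Lemma H2_L2 h : H2 h -> L2 h.
Proof. by case. Qed.

(** By the reproducing property, the inner product with [theta h] is the value of
    that function at a zero of [theta]. *)
Lemma model_szego p : model_space theta (on_circle (szego p)).
Proof.
split=> [|h /H2P[F Fh]]; first by apply/H2P; exists (szego p); exact: in_H2_szego.
have Fth := in_H2_blaschkeM Fh.
rewrite inner_conj; [|exact: in_H2_L2 Fth|exact: in_H2_L2 (in_H2_szego p)].
by rewrite (in_H2_eval Fth (a_disk p)) blaschke_root mulr0 conjC0.
Qed.

(** On the circle the dual kernel times the conjugate of [theta h] is the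
    conjugate of [z k h], an H^2 function vanishing at 0. *)
Lemma model_dual_kernel p : model_space theta (on_circle (dual_kernel p)).
Proof.
split=> [|h /H2P[F Fh]]; first by apply/H2P; exists (dual_kernel p); exact: in_H2_dual_kernel.
have H1 := in_H2MX (in_H2M_cauchy (a_diskJ p) Fh).
have := in_H2_mean H1; rewrite mulr0 => e.
rewrite /inner; rewrite -[RHS](conjC0) -e -circle_meanJ.
  congr circle_mean; apply/funext => t; rewrite /on_circle.
  have e1 : dual_kernel p (expi t) * (theta (expi t))^* = (expi t * szego p (expi t))^*.
    rewrite -circle_dualJ_blaschke [RHS](rmorphM Num.conj).
    by congr (_ * _); exact/esym/conjCK.
  rewrite (rmorphM Num.conj) mulrA [LHS](congr1 (fun z => z * _) e1) -[LHS](rmorphM Num.conj).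
  by congr Num.conj; rewrite -[cauchy _]/(szego p); ring.
exact/cintegrable_L2/(in_H2_L2 H1).
Qed.

Lemma model_L2 u : model_space theta u -> L2 u.
Proof. by case=> /H2_L2. Qed.

Lemma model_lin c u v : model_space theta u -> model_space theta v ->
  model_space theta (fun t => c * u t + v t).
Proof.
move=> [Hu ou] [Hv ov]; split.
  move/H2P: Hu => [F Fu]; move/H2P: Hv => [G Gv].
  by apply/H2P; eexists; exact: in_H2_lin Fu Gv.
move=> h Hh; have h2 := H2_L2 (H2M_blaschke Hh).
have u2 := H2_L2 Hu; have v2 := H2_L2 Hv.
rewrite innerDl//; last exact: L2Z.
by rewrite innerZl// ou// ov// mulr0 addr0.
Qed.

Lemma model0 : model_space theta (fun=> 0).
Proof.
split; first by apply/H2P; eexists; exact: in_H2_0.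
move=> h Hh; have h2 := H2_L2 (H2M_blaschke Hh).
apply: inner0_eq_circle; [exact: cmeasurable_cst|exact: h2|exact: eq_circle_refl].
Qed.

Lemma model_sum (I : Type) (s : seq I) (x : I -> C) (g : I -> R -> C) :
  (forall i, model_space theta (g i)) ->
  model_space theta (fun t => \sum_(i <- s) x i * g i t).
Proof.
move=> Kg; elim: s => [|i s IH].
  by under eq_fun do rewrite big_nil; exact: model0.
by under eq_fun do rewrite big_cons; exact: model_lin.
Qed.

(** The dual kernels are biorthogonal to the kernels, with the derivatives of
    [theta] at its zeros as normalization: coordinates in the basis of kernels are
    read off by inner products. *)
Lemma inner_szego_dual s t :
  inner (on_circle (szego s)) (on_circle (dual_kernel t)) =
  if s == t then (cderiv theta (a t))^* else 0.
Proof.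
rewrite inner_conj; [|exact: in_H2_L2 (in_H2_dual_kernel t)|exact: in_H2_L2 (in_H2_szego s)].
rewrite (in_H2_eval (in_H2_dual_kernel t) (a_disk s)).
case: eqP => [->|/eqP st]; first by rewrite blaschke_cderiv.
by rewrite dual_kernel_root ?conjC0.
Qed.

Definition root_poly : {poly C} := \prod_(i < k) ('X - (a i)%:P).
Definition denom_poly : {poly C} := \prod_(i < k) ((a i)^* *: 'X - 1).

Lemma circle_blaschke_denom t : theta (expi t) * denom_poly.[expi t] = root_poly.[expi t].
Proof.
have -> : denom_poly.[expi t] = \prod_(i < k) ((a i)^* * expi t - 1).
  rewrite horner_prod; apply: eq_bigr => i _.
  by rewrite hornerD hornerZ hornerX hornerN hornerC.
have -> : root_poly.[expi t] = \prod_(i < k) (expi t - a i).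
  by rewrite horner_prod; apply: eq_bigr => i _; rewrite hornerXsubC.
rewrite /blaschke -big_split; apply: eq_bigr => i _ /=.
have d0 : 1 - (a i)^* * expi t != 0 by rewrite disk_denom_neq0// norm_expi.
by field.
Qed.

Lemma size_root_poly : size root_poly = k.+1.
Proof.
rewrite /root_poly size_prod_XsubC; congr _.+1.
by rewrite [index_enum _]unlock -enumT size_enum_ord.
Qed.

Lemma inner_horner (c : nat -> C) F f (p : {poly C}) N : H2_series c F f -> (size p <= N)%N ->
  inner f (on_circle (horner p)) = \sum_(i < N) (p`_i)^* * c i.
Proof.
move=> Hf pN; have f2 := H2_series_L2 Hf.
transitivity (inner f (fun t => \sum_(i < N) p`_i * expi t ^+ i)).
  by congr inner; apply/funext => t; rewrite /on_circle (horner_coef_wide _ pN).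
rewrite inner_sumr//; last by move=> i; apply: L2Z; exact: L2_expi.
apply: eq_bigr => i _; rewrite innerZr//; last exact: L2_expi.
by rewrite (H2_coef i Hf).
Qed.

(** Orthogonality to the functions [theta z^j q], with [q] the denominator of
    [theta], is a linear recurrence for the Taylor coefficients whose
    characteristic roots are the conjugates of the zeros. *)
Lemma model_recurrence (c : nat -> C) F f j : H2_series c F f -> model_space theta f ->
  \sum_(i < k.+1) (root_poly`_i)^* * c (j + i)%N = 0.
Proof.
move=> Hf [_ of_].
have Hh : H2 (on_circle (horner (denom_poly * 'X^j))).
  by apply/H2P; eexists; exact: in_H2_horner.
have := of_ _ Hh.
have hM (p : {poly C}) t : (p * 'X^j).[expi t] = p.[expi t] * expi t ^+ j.
  by rewrite hornerM hornerXn.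
have -> : (fun t => on_circle theta t * on_circle (horner (denom_poly * 'X^j)) t) =
    on_circle (horner (root_poly * 'X^j)).
  apply/funext => t; rewrite /on_circle.
  by rewrite [RHS]hM -circle_blaschke_denom -mulrA -hM.
rewrite (inner_horner (N := j + k.+1) Hf); last first.
  by rewrite size_mulXn ?size_root_poly 1?addnC// -size_poly_eq0 size_root_poly.
rewrite big_split_ord /= big1 ?add0r; last first.
  by move=> i _; rewrite coefMXn ltn_ord conjC0 mul0r.
move=> E; rewrite -[RHS]E; apply: eq_bigr => i _.
by rewrite coefMXn ltnNge leq_addr /= addKn.
Qed.

Lemma power_recurrence p j : \sum_(i < k.+1) (root_poly`_i)^* * (a p)^* ^+ (j + i) = 0.
Proof.
have r0 : root_poly.[a p] = 0.
  by rewrite horner_prod (bigD1 p)//= !hornerE subrr mul0r.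
have := congr1 (fun z => (a p)^* ^+ j * z^*) r0.
rewrite /= conjC0 mulr0 (horner_coef_wide _ (eq_leq size_root_poly)).
rewrite rmorph_sum mulr_sumr => E.
rewrite -[RHS]E; apply: eq_bigr => i _; rewrite rmorphM rmorphXn /= exprD; ring.
Qed.

Lemma recurrence_unique (d : nat -> C) :
  (forall j, \sum_(i < k.+1) (root_poly`_i)^* * d (j + i)%N = 0) ->
  (forall n, (n < k)%N -> d n = 0) -> forall n, d n = 0.
Proof.
move=> rec d0; elim/ltn_ind => n IH; have [/d0//|kn] := ltnP n k.
have := rec (n - k)%N; rewrite big_ord_recr /= subnK// big1 ?add0r; last first.
  move=> i _; rewrite IH ?mulr0//.
  by have := ltn_ord i; rewrite -(ltn_add2l (n - k)) subnK.
have -> : root_poly`_k = 1.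
  have := monicP (monic_prod_XsubC (index_enum 'I_k) xpredT a).
  by rewrite -/root_poly lead_coefE size_root_poly.
by rewrite conjC1 mul1r.
Qed.

(** A Vandermonde system with distinct nodes. *)
Lemma interpolate_powers (c : nat -> C) : exists x : 'I_k -> C,
  forall n, (n < k)%N -> c n = \sum_p x p * (a p)^* ^+ n.
Proof.
pose V : 'M[C]_k := Vandermonde k (\row_p (a p)^*).
have uV : V \in unitmx.
  rewrite unitmxE det_Vandermonde unitfE; apply/prodf_neq0 => i _; apply/prodf_neq0 => j ij.
  rewrite !mxE subr_eq0 (inj_eq (can_inj (@conjCK _))) (inj_eq a_inj).
  by apply: contraTneq ij => ->; rewrite ltnn.
pose y := invmx V *m (\col_n c n).
exists (fun p => y p 0) => n nk.
have : (V *m y) (Ordinal nk) 0 = c n by rewrite mulKVmx// mxE.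
by rewrite mxE => <-; apply: eq_bigr => p _; rewrite !mxE mulrC.
Qed.

(** The Taylor coefficients solve the recurrence, hence are a combination of
    powers of the conjugate zeros, which are the coefficients of the kernels. *)
Lemma model_span f : model_space theta f -> exists x : 'I_k -> C,
  eq_circle f (fun t => \sum_p x p * on_circle (szego p) t).
Proof.
move=> /[dup] Kf [/H2_seriesP[c [F Hf]] _].
have [x cx] := interpolate_powers c; exists x.
have Hk p := H2_series_cauchy (a_diskJ p).
have Hs := H2_series_sum (index_enum _) x Hk.
apply: (H2_series_eq Hf); apply: H2_series_ext Hs => // n.
apply/esym/eqP; rewrite -subr_eq0; apply/eqP.
apply: (recurrence_unique (d := fun n => c n - \sum_p x p * (a p)^* ^+ n)) => [j|m mk]; last first.
  by rewrite cx// subrr.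
under eq_bigr do rewrite mulrBr; rewrite sumrB (model_recurrence j Hf Kf) sub0r.
under eq_bigr do rewrite mulr_sumr; rewrite exchange_big big1 ?oppr0// => p _ /=.
under eq_bigr do rewrite mulrCA; by rewrite -mulr_sumr power_recurrence mulr0.
Qed.

(** Such a function is orthogonal to the kernels, which span the space. *)
Lemma model_eq0 F u : in_H2 F u -> model_space theta u -> (forall p, F (a p) = 0) ->
  eq_circle u (fun=> 0).
Proof.
move=> Fu Ku F0; have u2 := in_H2_L2 Fu; have mu1 := L2_cmeasurable u2.
have [x ux] := model_span Ku.
have s2 p : L2 (on_circle (szego p)) := in_H2_L2 (in_H2_szego p).
have x2 p : L2 (fun t => x p * on_circle (szego p) t) by exact: L2Z.
apply: L2norm0_eq_circle => //; apply/eqP; rewrite -sqrf_eq0; apply/eqP.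
apply: complexI; rewrite -inner_self rmorph0.
rewrite (eq_circle_inner mu1 mu1 mu1 _ (eq_circle_refl u) ux); last first.
  by apply: L2_cmeasurable; exact: L2_sum.
rewrite inner_sumr// big1// => p _.
by rewrite innerZr// (in_H2_eval Fu (a_disk p)) F0 mulr0.
Qed.

(** Lagrange interpolation at the zeros: the dual kernel at [a p] vanishes at the
    other zeros. *)
Lemma model_dual_span f : model_space theta f -> exists x : 'I_k -> C,
  eq_circle f (fun t => \sum_p x p * on_circle (dual_kernel p) t).
Proof.
move=> /[dup] Kf [/H2P[F Ff] _].
pose x p := F (a p) / dual_kernel p (a p); exists x.
have Hs := in_H2_sum (index_enum _) x in_H2_dual_kernel.
have Ks := model_sum (index_enum _) x model_dual_kernel.
have : eq_circle (fun t => -1 * (\sum_p x p * on_circle (dual_kernel p) t) + f t) (fun=> 0).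
  apply: model_eq0 (in_H2_lin (-1) Hs Ff) (model_lin (-1) Ks Kf) _ => p.
  rewrite (bigD1 p)//= big1 ?addr0 => [|i ip].
    by rewrite divfK ?dual_kernel_neq0// mulN1r addNr.
  by rewrite dual_kernel_root ?mulr0// eq_sym.
apply: circle_aeS => t h Dt; have /eqP := h Dt.
by rewrite mulN1r addrC subr_eq0 => /eqP.
Qed.

End BlaschkeModel.

(** * Interpolation and norm estimates *)

(** One node at a time: the square of the polynomial with the previous nodes as
    roots has double zeros there, so adding a multiple of it by an affine factor
    adjusts value and slope at the new node only. *)
Lemma hermite_interpolation (F : fieldType) (y y' : F -> F) (s : seq F) : uniq s ->
  exists Q : {poly F}, forall x, x \in s -> Q.[x] = y x /\ Q^`().[x] = y' x.
Proof.
elim: s => [|x s IH] /=; first by exists 0.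
move=> /andP[xs /IH[Q HQ]]; pose P := \prod_(z <- s) ('X - z%:P).
have rootP z : (P.[z] == 0) = (z \in s) by rewrite -[_ == 0]/(root P z) root_prod_XsubC.
have [P2 P2E P2'E] : exists2 P2, forall z, P2.[z] = P.[z] ^+ 2 &
    forall z, P2^`().[z] = 2 * P.[z] * P^`().[z].
  by exists (P ^+ 2) => z; rewrite ?expr2 ?derivM !hornerE ?expr2//; ring.
have P2x : P2.[x] != 0 by rewrite P2E expf_neq0// rootP.
pose c := (y x - Q.[x]) / P2.[x].
pose d := (y' x - Q^`().[x] - c * P2^`().[x]) / P2.[x].
pose T := Q + (c%:P + d *: ('X - x%:P)) * P2.
have TE z : T.[z] = Q.[z] + (c + d * (z - x)) * P2.[z] by rewrite /T !hornerE.
have T'E z : T^`().[z] = Q^`().[z] + d * P2.[z] + (c + d * (z - x)) * P2^`().[z].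
  by rewrite /T derivD derivM derivD derivC derivZ derivXsubC !hornerE.
exists T => z; rewrite inE TE T'E => /orP[/eqP->|zs].
  rewrite subrr mulr0 addr0 /d /c !divfK//; split; ring.
have /eqP Pz : P.[z] == 0 by rewrite rootP.
have [-> ->] := HQ z zs.
by rewrite P2E P2'E Pz expr0n !(mulr0, mul0r, addr0).
Qed.

Section CirclePolynomials.
Variable R : realType.
Local Notation C := R[i].
Local Notation mu := (@lebesgue_measure R).
Local Notation D := (`[0, 2 * pi]%classic : set R).
Implicit Types (u v w f h : R -> C) (c z : C) (Q : {poly C}).

Lemma horner_circle_bounded Q : exists K : R, forall t, sqmod (Q.[expi t]) <= K.
Proof.
elim/poly_ind: Q => [|Q c [K QK]].
  by exists 0 => t; rewrite horner0 sqmod0.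
exists (2 * K + 2 * sqmod c) => t; rewrite !hornerE.
apply: le_trans (sqmodD_le _ _) _; rewrite lerD2r ler_pM2l//.
by rewrite sqmodM sqmod_expi mulr1.
Qed.

(** For [Q = Q1 * (X - b) + Q(b)], the value [Q1(a)] is the divided difference of
    [Q] at [a] and [b], that is [Q'(a)] when [a = b]. On the circle
    [conj (z k_b) = 1 / (z - b)], so [Q conj (z k_b)] is [Q1] plus [Q(b)] times the
    conjugate of a function vanishing at 0, and pairing with [k_a] evaluates [Q1]
    at [a]. *)
Lemma mean_divided_difference Q1 (y : C) (a b : C) : `|a| < 1 -> `|b| < 1 ->
  circle_mean (fun t => ((Q1 * ('X - b%:P) + y%:P).[expi t])^* *
    (expi t * cauchy a^* (expi t) * cauchy b^* (expi t))) = (Q1.[a])^*.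
Proof.
move=> a1 b1.
have aJ : `|a^*| < 1 by rewrite norm_conjC.
have bJ : `|b^*| < 1 by rewrite norm_conjC.
have ka2 := in_H2_L2 (in_H2_cauchy aJ).
have q2 := in_H2_L2 (in_H2_horner Q1).
have Hab := in_H2MX (in_H2M_cauchy bJ (in_H2_cauchy aJ)).
have E1 : circle_mean (fun t => on_circle (cauchy a^*) t * (on_circle (horner Q1) t)^*) =
    (Q1.[a])^*.
  rewrite -[LHS]/(inner _ _) inner_conj//.
  by rewrite (in_H2_eval (in_H2_horner Q1) a1).
have E2 := in_H2_mean Hab; rewrite mulr0 in E2.
have i1 : cintegrable (fun t => on_circle (cauchy a^*) t * (on_circle (horner Q1) t)^*).
  exact: cintegrable_inner.
have i2 := cintegrable_L2 (in_H2_L2 Hab).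
rewrite -[RHS]addr0 -(mulr0 y^*) -E1 -E2 -circle_meanZ// -circle_meanD//; last exact: cintegrableZ.
congr circle_mean; apply/funext => t; rewrite /on_circle hornerD hornerM hornerXsubC hornerC.
have h := circle_sub_neq0 t b1; have h1 := expi_unit t.
have key : (expi t - b)^* * (expi t * cauchy b^* (expi t)) = 1.
  apply: (can_inj (@conjCK _)); rewrite !(rmorphM Num.conj) (rmorph1 Num.conj) /= conjCK.
  rewrite circle_cauchyJ// conj_expi.
  by field; rewrite h h1.
rewrite [in LHS](rmorphD Num.conj) [in LHS](rmorphM Num.conj).
set qa := (Q1.[expi t])^*; set eb := (expi t - b)^* in key *.
set ka := cauchy _ _; set kb := cauchy _ _ in key *.
rewrite (_ : (qa * eb + y^*) * (expi t * ka * kb) =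
  qa * ka * (eb * (expi t * kb)) + y^* * (ka * kb * expi t)); last by ring.
by rewrite key mulr1 mulrC.
Qed.

Lemma cauchy_difference (a b z : C) : `|a| < 1 -> `|b| < 1 -> `|z| <= 1 ->
  (a - b) * (z * cauchy a z * cauchy b z) = cauchy a z - cauchy b z.
Proof.
move=> a1 b1 z1; rewrite /cauchy.
have ha := disk_denom_neq0 a1 z1; have hb := disk_denom_neq0 b1 z1.
by field; rewrite ha hb.
Qed.

Lemma L2norm_eq_circle u v : cmeasurable u -> cmeasurable v -> eq_circle u v ->
  L2norm u ^+ 2 = L2norm v ^+ 2.
Proof.
move=> mu1 mv uv; apply: complexI; rewrite -!inner_self.
exact: eq_circle_inner.
Qed.

Lemma L2normZ c u : L2 u -> L2norm (fun t => c * u t) ^+ 2 = sqmod c * L2norm u ^+ 2.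
Proof.
move=> u2; apply: complexI; rewrite -inner_self innerZl ?innerZr//; try exact: L2Z.
by rewrite mulrA mulcJ inner_self [RHS]rmorphM.
Qed.

Lemma L2normD_le u v : L2 u -> L2 v ->
  L2norm (fun t => u t + v t) ^+ 2 <= 2 * L2norm u ^+ 2 + 2 * L2norm v ^+ 2.
Proof.
move=> u2 v2; have [_ iuv] := (L2_integrable _).1 (L2D u2 v2).
have [_ iu] := (L2_integrable _).1 u2; have [_ iv] := (L2_integrable _).1 v2.
have i2 (f : R -> R) : mu.-integrable D (EFin \o f) ->
    mu.-integrable D (EFin \o (fun t => 2 * f t)).
  by move=> fi; under [X in _.-integrable _ X]eq_fun do rewrite /= EFinM; exact: integrableZl.
have i2u := i2 _ iu; have i2v := i2 _ iv.
have i2uv : mu.-integrable D (EFin \o (fun t => 2 * sqmod (u t) + 2 * sqmod (v t))).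
  by under [X in _.-integrable _ X]eq_fun do rewrite /= EFinD; exact: integrableD.
have p0 : 0 <= (2 * pi)^-1 :> R by rewrite invr_ge0 ltW// twopi_gt0.
have h := @le_Rintegral _ _ _ mu D _ _ (@measurable_circle R) iuv i2uv
  (fun t _ => sqmodD_le (u t) (v t)).
rewrite !L2norm_sqr; apply: le_trans (ler_wpM2l p0 h) _.
by rewrite RintegralD// !RintegralZl//; lra.
Qed.

End CirclePolynomials.

(** * Matrices of asymmetric truncated Toeplitz operators *)

Section ATTOCharacterization.
Variable R : realType.
Local Notation C := R[i].
Local Notation mu := (@lebesgue_measure R).
Local Notation D := (`[0, 2 * pi]%classic : set R).
Variables (m n : nat) (a : 'I_m -> C) (b : 'I_n -> C).
Hypotheses (a_disk : forall i, `|a i| < 1) (b_disk : forall j, `|b j| < 1).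
Hypotheses (a_inj : injective a) (b_inj : injective b).
Variable A : (R -> C) -> (R -> C).
Hypothesis A_lin : linear_transformation (model_space (blaschke a)) (model_space (blaschke b)) A.
Variable r : 'M[C]_(n, m).
Hypothesis r_repr : matrix_repr a b A r.

Local Notation alpha := (blaschke a).
Local Notation beta := (blaschke b).
Local Notation ka p := (on_circle (szego a p)).
Local Notation kb s := (on_circle (szego b s)).
Local Notation da p := (on_circle (dual_kernel a p)).
Local Notation db s := (on_circle (dual_kernel b s)).

Let L2_ka p : L2 (ka p).
Proof. exact: in_H2_L2 (in_H2_szego a_disk p). Qed.

Let L2_kb s : L2 (kb s).
Proof. exact: in_H2_L2 (in_H2_szego b_disk s). Qed.

Let L2_da p : L2 (da p).
Proof. exact: in_H2_L2 (in_H2_dual_kernel a_disk p). Qed.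

Let L2_db s : L2 (db s).
Proof. exact: in_H2_L2 (in_H2_dual_kernel b_disk s). Qed.

Let model_A f : model_space alpha f -> model_space beta (A f).
Proof. exact: A_lin.1. Qed.

Let L2_Aka p : L2 (A (ka p)).
Proof. exact/(@model_L2 _ _ b)/model_A/model_szego. Qed.

Lemma A_szego p : eq_circle (A (ka p)) (fun t => \sum_s r s p * kb s t).
Proof.
have := r_repr p; rewrite kernel_szego => h; apply: eq_circle_trans h _.
by apply: aeW => t _; apply: eq_bigr => s _; rewrite kernel_szego.
Qed.

Lemma inner_A_dual p t : inner (A (ka p)) (db t) = r t p * (cderiv beta (b t))^*.
Proof.
have L2r s : L2 (fun t => r s p * kb s t) by exact: L2Z.
rewrite (eq_circle_inner (L2_cmeasurable (L2_Aka p))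
  (L2_cmeasurable (L2_sum (index_enum _) L2r))
  (L2_cmeasurable (L2_db t)) (L2_cmeasurable (L2_db t)) (A_szego p) (eq_circle_refl _)).
rewrite inner_suml// (bigD1 t)//= big1 ?addr0 => [|s st].
  by rewrite innerZl// (inner_szego_dual b_disk b_inj) eqxx.
by rewrite innerZl// (inner_szego_dual b_disk b_inj) (negbTE st) mulr0.
Qed.

(** [A] is linear only up to equality almost everywhere on the circle, so it has
    to be carried through the sum one term at a time; [A 0] vanishes because it
    equals twice itself. *)
Lemma A_sum f (x : 'I_m -> C) : model_space alpha f ->
  eq_circle f (fun t => \sum_p x p * ka p t) ->
  eq_circle (A f) (fun t => \sum_p x p * A (ka p) t).
Proof.
move=> Kf fx; have K0 := model0 a_disk; have Kk p := model_szego a_disk p.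
have A0 : eq_circle (A (fun=> 0)) (fun=> 0).
  have := A_lin.2 1 _ _ _ K0 K0 K0 => /(_ _)[].
    by apply: aeW => t _; rewrite mulr0 addr0.
  move=> N [mN N0 sN]; exists N; split=> //.
  apply: subset_trans sN => t /= h1 h2; apply: h1 => Dt.
  have /eqP := h2 Dt; rewrite mul1r -[eqbLHS]addr0 (inj_eq (addrI _)) => /eqP/esym.
  by [].
have Asum (s : seq 'I_m) : eq_circle (A (fun t => \sum_(p <- s) x p * ka p t))
    (fun t => \sum_(p <- s) x p * A (ka p) t).
  elim: s => [|p s IH].
    apply: eq_circle_trans (_ : eq_circle _ (fun=> 0)) _.
      by under [X in A X]eq_fun do rewrite big_nil.
    by apply: aeW => t _; rewrite big_nil.
  have := A_lin.2 (x p) _ _ _ (Kk p) (model_sum a_disk s x Kk)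
    (model_sum a_disk (p :: s) x Kk).
  move=> /(_ _)/eq_circle_trans; apply.
    by apply: aeW => t _; rewrite big_cons.
  move: IH; apply: circle_aeS => t h Dt; rewrite h// big_cons//.
have := A_lin.2 0 _ _ _ K0 (model_sum a_disk (index_enum _) x Kk) Kf.
move=> /(_ _)/eq_circle_trans; apply.
  by move: fx; apply: circle_aeS => t h Dt; rewrite h// mul0r add0r.
by move: (Asum (index_enum _)); apply: circle_aeS => t h Dt; rewrite h// mul0r add0r.
Qed.

(** Every operator between the two spaces is bounded, because the coordinates
    of [f] in the basis of kernels are inner products of [f] with multiples of
    the dual kernels. *)
Lemma A_bounded : bounded_operator (model_space alpha) A.
Proof.
have [L HL] : exists L : 'I_m -> R, forall f (x : 'I_m -> C), model_space alpha f ->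
    eq_circle f (fun t => \sum_p x p * ka p t) ->
    forall p, sqmod (x p) <= L p * L2norm f ^+ 2.
  exists (fun p => L2norm (da p) ^+ 2 / sqmod (cderiv alpha (a p))) => f x Kf fx p.
  have f2 := model_L2 Kf.
  have L2x q : L2 (fun t => x q * ka q t) by exact: L2Z.
  have E : inner f (da p) = x p * (cderiv alpha (a p))^*.
    rewrite (eq_circle_inner (L2_cmeasurable f2)
      (L2_cmeasurable (L2_sum (index_enum _) L2x))
      (L2_cmeasurable (L2_da p)) (L2_cmeasurable (L2_da p)) fx (eq_circle_refl _)).
    rewrite inner_suml// (bigD1 p)//= big1 ?addr0 => [|s st].
      by rewrite innerZl// (inner_szego_dual a_disk a_inj) eqxx.
    by rewrite innerZl// (inner_szego_dual a_disk a_inj) (negbTE st) mulr0.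
  have s0 : 0 < sqmod (cderiv alpha (a p)).
    rewrite lt_neqAle sqmod_ge0 andbT eq_sym blaschke_cderiv//.
    by apply: contraNneq (dual_kernel_neq0 a_disk a_inj p) => /sqmod_eq0 ->.
  rewrite mulrAC ler_pdivlMr//; have := Cauchy_Schwarz f2 (L2_da p).
  by rewrite E sqmodM sqmodJ mulrC [X in _ <= X]mulrC mulrC.
have [M [M0 HM]] : exists M : R, 0 <= M /\ forall f, model_space alpha f ->
    L2norm (A f) ^+ 2 <= M * L2norm f ^+ 2.
  have bound (s : seq 'I_m) : exists M : R, 0 <= M /\ forall (x : 'I_m -> C) (T : R), 0 <= T ->
      (forall p, sqmod (x p) <= L p * T) ->
      L2norm (fun t => \sum_(p <- s) x p * A (ka p) t) ^+ 2 <= M * T.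
    elim: s => [|p s [M [M0 IH]]].
      exists 0; split=> // x T T0 _; under eq_fun do rewrite big_nil.
      by rewrite L2norm_sqr sqmod0 Rintegral_circle_cst !(mul0r, mulr0).
    exists (2 * (`|L p| * L2norm (A (ka p)) ^+ 2) + 2 * M); split.
      by apply: addr_ge0; apply: mulr_ge0 => //; apply: mulr_ge0 => //; exact: sqr_ge0.
    move=> x T T0 HT; under eq_fun do rewrite big_cons.
    have L2x q : L2 (fun t => x q * A (ka q) t) by exact: L2Z.
    apply: le_trans (L2normD_le (L2x p) (L2_sum s L2x)) _.
    rewrite [leRHS]mulrDl -[X in _ <= X + _]mulrA -[X in _ <= _ + X]mulrA.
    apply: lerD; rewrite ler_pM2l//; last exact: IH.
    rewrite L2normZ// mulrAC; apply: ler_wpM2r; first exact: sqr_ge0.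
    by apply: le_trans (HT p) _; apply: ler_wpM2r => //; exact: ler_norm.
  have [M [M0 HM]] := bound (index_enum _); exists M; split=> // f Kf.
  have [x fx] := model_span a_disk a_inj Kf.
  have L2x q : L2 (fun t => x q * A (ka q) t) by exact: L2Z.
  rewrite (L2norm_eq_circle _ _ (A_sum Kf fx)).
  - exact: (HM x _ (sqr_ge0 _) (HL _ _ Kf fx)).
  - exact/L2_cmeasurable/(@model_L2 _ _ b)/model_A.
  - exact/L2_cmeasurable/L2_sum.
exists (Num.sqrt M) => f Kf.
rewrite -(@ler_pXn2r _ 2)// ?nnegrE ?mulr_ge0 ?sqrtr_ge0 ?L2norm_ge0//.
by rewrite exprMn (sqr_sqrtr M0); exact: HM.
Qed.

(** The conjugate of the dual kernel of [beta] is [z k_b] times the conjugate of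
    [beta], which turns the matrix entries of the symbol [phi] into integrals of
    [phi conj beta] against the products [z k_a k_b]. *)
Lemma circle_cross_kernels (phi : R -> C) p s t :
  phi t * ka p t * (db s t)^* =
  (phi t * (beta (expi t))^*) *
    (expi t * cauchy (a p)^* (expi t) * cauchy (b s)^* (expi t)).
Proof.
have -> : (db s t)^* = (beta (expi t))^* * (expi t * szego b s (expi t)).
  rewrite -circle_dualJ_blaschke// mulrCA [_^* * beta _]mulrC circle_blaschke_unit//.
  by rewrite mulr1.
by rewrite /on_circle /szego; ring.
Qed.

Let sqmod_beta t : sqmod (beta (expi t)) = 1.
Proof. by apply: complexI; rewrite -mulcJ circle_blaschke_unit. Qed.

(** Partial fractions split [(conj a - conj b) z k_a k_b] as [k_a - k_b], so the
    entries are differences of values of [w |-> mean (phi conj beta k_w)]. *)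
Lemma ATTO_separated : ATTO alpha beta A -> exists U : C -> C, forall p s,
  (cderiv beta (b s))^* * ((a p)^* - (b s)^*) * r s p = U (a p) - U (b s).
Proof.
move=> [phi [phi2 Aphi _]].
pose psi t := phi t * (beta (expi t))^*.
have mbeta : cmeasurable (fun t => (beta (expi t))^*).
  apply: cmeasurableJ; have := in_H2M_blaschke b_disk (in_H2_1 R) => /in_H2_L2/L2_cmeasurable.
  by under eq_fun do rewrite mul1r.
have psi2 : L2 psi.
  have : L2 (fun t => (beta (expi t))^* * phi t).
    apply: (L2M_bounded phi2 mbeta (K := 1)) => t _.
    by rewrite sqmodJ sqmod_beta.
  by under eq_fun do rewrite mulrC.
pose U w := circle_mean (fun t => psi t * cauchy w^* (expi t)).
have iU w : `|w| < 1 -> cintegrable (fun t => psi t * cauchy w^* (expi t)).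
  move=> w1; apply: cintegrable_mul => //; apply: (in_H2_L2 (F := cauchy w^*)).
  by apply: in_H2_cauchy; rewrite norm_conjC.
exists U => p s.
have [phik2 _ orth] := Aphi _ (model_szego a_disk p).
have := orth _ (model_dual_kernel b_disk s).
rewrite innerBl// inner_A_dual => /eqP; rewrite subr_eq0 => /eqP E.
rewrite mulrAC [X in X * _](mulrC _ (r s p)) -E [LHS]mulrC /inner.
rewrite -[LHS]circle_meanZ; last exact: cintegrable_inner.
rewrite /U -[X in _ = _ + X]mulN1r -[X in _ = _ + X]circle_meanZ; last exact: iU.
rewrite -circle_meanD; [|exact: iU|exact/cintegrableZ/iU].
congr circle_mean; apply/funext => t; rewrite circle_cross_kernels mulrCA cauchy_difference.
- by rewrite -/(psi t); ring.
- by rewrite norm_conjC.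
- by rewrite norm_conjC.
- by rewrite norm_expi.
Qed.

(** The symbol is [beta conj Q] with [Q] a polynomial: its matrix entries are the
    conjugates of divided differences of [Q] at pairs of zeros. Away from the common
    zeros these are determined by the values [conj (U x)] of [Q]; at a common zero,
    where the hypothesis says nothing on the entry, the slope of [Q] is prescribed. *)
Lemma separated_ATTO (U : C -> C) : (forall p s,
    (cderiv beta (b s))^* * ((a p)^* - (b s)^*) * r s p = U (a p) - U (b s)) ->
  ATTO alpha beta A.
Proof.
move=> HU.
pose B s := (cderiv beta (b s))^*.
(* The slopes of Q; a common zero determines its two indices by injectivity. *)
have [y' Hy'] : exists y' : C -> C, forall p s, a p = b s -> y' (b s) = (B s * r s p)^*.
  exists (fun x => if [pick q : 'I_m * 'I_n | (a q.1 == x) && (b q.2 == x)] is Some q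
    then (B q.2 * r q.2 q.1)^* else 0) => p s ps.
  case: pickP => [[p' s'] /= /andP[/eqP e1 /eqP/b_inj ->]|/(_ (p, s))].
    by move: e1; rewrite -ps => /a_inj ->.
  by rewrite /= ps eqxx.
have [Q HQ] := hermite_interpolation (fun x => (U x)^*) y'
  (undup_uniq (codom a ++ codom b)).
have Qa p : Q.[a p] = (U (a p))^*.
  have ap : a p \in undup (codom a ++ codom b) by rewrite mem_undup mem_cat codom_f.
  by case: (HQ _ ap).
have Qb s : Q.[b s] = (U (b s))^* /\ Q^`().[b s] = y' (b s).
  by apply: HQ; rewrite mem_undup mem_cat codom_f orbT.
pose phi t := beta (expi t) * (Q.[expi t])^*.
have main p s : circle_mean (fun t => phi t * ka p t * (db s t)^*) = r s p * B s.
  have [Q1 Q1E] : exists Q1, Q - (Q.[b s])%:P = Q1 * ('X - (b s)%:P).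
    by apply/factor_theorem; rewrite /root !hornerE subrr.
  have {}Q1E : Q = Q1 * ('X - (b s)%:P) + (Q.[b s])%:P by rewrite -Q1E subrK.
  transitivity ((Q1.[a p])^*).
    rewrite -(mean_divided_difference Q1 Q.[b s] (a_disk p) (b_disk s)) -Q1E.
    congr circle_mean; apply/funext => t; rewrite circle_cross_kernels /phi.
    by rewrite [X in X * _]mulrAC circle_blaschke_unit// mul1r.
  have [ps|ps] := eqVneq (a p) (b s).
    have : Q^`().[b s] = Q1.[b s].
      by rewrite Q1E derivD derivM derivC derivXsubC !hornerE subrr mulr0 add0r.
    by rewrite (Qb s).2 (Hy' p s ps) ps => <-; rewrite conjCK mulrC.
  have abn : a p - b s != 0 by rewrite subr_eq0.
  have Q1a : Q1.[a p] = (Q.[a p] - Q.[b s]) / (a p - b s).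
    apply: (canRL (mulfK abn)).
    have := congr1 (fun P => P.[a p]) Q1E; rewrite [RHS]hornerD hornerM hornerXsubC hornerC => ->.
    by rewrite addrK.
  rewrite Q1a Qa (Qb s).1 -rmorphB -HU fmorph_div rmorphB /= conjCK -/(B s).
  have abn' : (a p)^* - (b s)^* != 0 by rewrite -rmorphB conjC_eq0.
  by field.
have [K QK] := horner_circle_bounded Q.
have mphi : cmeasurable phi.
  apply: cmeasurableM.
    have := in_H2M_blaschke b_disk (in_H2_1 R) => /in_H2_L2/L2_cmeasurable.
    by under eq_fun do rewrite mul1r.
  by apply: cmeasurableJ; exact: L2_cmeasurable (in_H2_L2 (in_H2_horner Q)).
have phiK t : D t -> sqmod (phi t) <= K.
  by move=> _; rewrite /phi sqmodM sqmod_beta mul1r sqmodJ.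
exists phi; split; [exact: L2_bounded phiK| |exact: A_bounded].
move=> f Kf; have f2 := model_L2 Kf.
have phif2 : L2 (fun t => phi t * f t) by exact: L2M_bounded phiK.
split=> //; first exact: model_A.
move=> h Kh; have h2 := model_L2 Kh; have Af2 := model_L2 (model_A Kf).
have [x fx] := model_span a_disk a_inj Kf.
have [y hy] := model_dual_span b_disk b_inj Kh.
have phik2 p : L2 (fun t => phi t * ka p t) by exact: L2M_bounded phiK.
have d2 p : L2 (fun t => phi t * ka p t - A (ka p) t) by exact: L2B.
have xd2 p : L2 (fun t => x p * (phi t * ka p t - A (ka p) t)) by exact: L2Z.
have yd2 s : L2 (fun t => y s * db s t) by exact: L2Z.
transitivity (inner (fun t => \sum_p x p * (phi t * ka p t - A (ka p) t))
    (fun t => \sum_s y s * db s t)).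
  apply: eq_circle_inner => //;
    try by apply: L2_cmeasurable; (exact: h2 || exact: L2B || exact: L2_sum).
  move: fx (A_sum Kf fx); apply: circle_aeS2 => t e1 e2 Dt; rewrite e1// e2//.
  rewrite mulr_sumr -sumrB; apply: eq_bigr => p _; ring.
rewrite inner_suml//; last exact: L2_sum.
rewrite big1// => p _; rewrite innerZl//; last exact: L2_sum.
rewrite inner_sumr// big1 ?mulr0// => s _; rewrite innerZr// innerBl// inner_A_dual.
by rewrite [X in X - _](main p s) subrr mulr0.
Qed.

End ATTOCharacterization.

(** * Indices of the common zeros *)

Section CommonZeros.
Variables (T : choiceType) (m n l : nat) (a : 'I_m.+1 -> T) (b : 'I_n.+1 -> T).
Hypotheses (a_inj : injective a) (b_inj : injective b).
Hypothesis card_common : (range a `&` range b #= `I_l)%card.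
Hypothesis common : forall (i : 'I_m.+1) (j : 'I_n.+1),
  i = j :> nat -> (i < l)%N -> a i = b j.

(** The first [l] zeros are already [l] common zeros, so by counting there are no
    others. *)
Lemma common_zeros : [/\ (l <= m.+1)%N, (l <= n.+1)%N &
  forall p s, a p = b s -> p = s :> nat /\ (p < l)%N].
Proof.
pose P := [set p | [exists s, a p == b s]]%SET.
have cardP : #|P| = l.
  have aE : range a `&` range b = (fun i : 'I_#|P| => a (enum_val i)) @` setT.
    apply/seteqP; split=> [_ [[p _ <-] [s _ sp]]|_ [i _ <-]] /=.
      have pP : p \in P by rewrite inE; apply/existsP; exists s; rewrite sp.
      by exists (enum_rank_in pP p) => //; rewrite enum_rankK_in.
    split; first by exists (enum_val i).
    by have := enum_valP i; rewrite inE => /existsP[s /eqP->]; exists s.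
  have e_inj : {in setT &, injective (fun i : 'I_#|P| => a (enum_val i))}.
    by move=> i j _ _ /a_inj/enum_val_inj.
  apply/esym/card_eq_II; apply: card_esym.
  apply: card_eq_trans card_II _; rewrite card_eq_sym.
  apply: card_eq_trans (inj_card_eq e_inj); rewrite -aE; exact: card_esym.
have lm : (l <= m.+1)%N by rewrite -cardP -[leqRHS]card_ord max_card.
have ln : (l <= n.+1)%N.
  pose f p := odflt ord0 [pick s | a p == b s].
  have fP p : p \in P -> a p = b (f p).
    rewrite inE /f => /existsP[s ps]; case: pickP => [s' /eqP//|/(_ s)].
    by rewrite ps.
  rewrite -cardP -(card_in_imset (f := f)) => [|p q /fP pE /fP qE fpq].
    by rewrite -[leqRHS]card_ord max_card.
  by apply: a_inj; rewrite pE qE fpq.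
split=> // p s ps.
have sub : [set q : 'I_m.+1 | (q < l)%N]%SET \subset P.
  apply/fintype.subsetP => q; rewrite !inE => ql; apply/existsP; exists (inord q).
  by apply/eqP/common => //; rewrite inordK// (leq_trans ql).
have cardl : #|[set q : 'I_m.+1 | (q < l)%N]%SET| = l.
  have -> : [set q : 'I_m.+1 | (q < l)%N]%SET = [set widen_ord lm i | i in 'I_l]%SET.
    apply/setP => q; rewrite inE; apply/idP/imsetP => [ql|[i _ ->]]; last exact: ltn_ord i.
    by exists (Ordinal ql) => //; exact: val_inj.
  rewrite card_imset ?card_ord// => i j /(congr1 val) /= ij; exact: val_inj.
have PE : [set q : 'I_m.+1 | (q < l)%N]%SET = P.
  by apply/eqP; rewrite eqEcard; apply/andP; split; [exact: sub|rewrite cardP cardl].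
have pl : (p < l)%N.
  by have : p \in P; [rewrite inE; apply/existsP; exists s; rewrite ps|rewrite -PE inE].
split=> //; have ap := common (j := inord p) _ pl.
move: ap; rewrite inordK ?(leq_trans pl)// => /(_ erefl); rewrite ps => /b_inj ->.
by rewrite inordK// (leq_trans pl).
Qed.

End CommonZeros.

(** * Elimination of the separating function *)

Lemma glue_functions (T X : Type) (m n : nat) (a : 'I_m -> T) (b : 'I_n -> T)
    (v : 'I_m -> X) (w : 'I_n -> X) (x0 : X) :
  injective a -> injective b -> (forall p s, a p = b s -> v p = w s) ->
  exists U : T -> X, (forall p, U (a p) = v p) /\ (forall s, U (b s) = w s).
Proof.
move=> a_inj b_inj vw.
exists (fun x => if pselect (exists p, a p = x) is left h then v (sval (cid h))
  else if pselect (exists s, b s = x) is left h then w (sval (cid h)) else x0).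
split=> [p|s].
  case: pselect => [h|[]]; last by exists p.
  by case: (cid h) => q /= /a_inj ->.
case: pselect => [h|_]; first by case: (cid h) => p /= /vw.
case: pselect => [h|[]]; last by exists s.
by case: (cid h) => q /= /b_inj ->.
Qed.

Theorem theorem3p1 (R : realType) (m n l : nat)
    (a : 'I_m.+1 -> R[i]) (b : 'I_n.+1 -> R[i])
    (a_disk : forall i, `|a i| < 1) (b_disk : forall j, `|b j| < 1)
    (a_inj : injective a) (b_inj : injective b)
    (card_common : (range a `&` range b #= `I_l)%card)
    (common : forall (i : 'I_m.+1) (j : 'I_n.+1),
        i = j :> nat -> (i < l)%N -> a i = b j)
    (A : (R -> R[i]) -> (R -> R[i]))
    (A_lin : linear_transformation (model_space (blaschke a))
               (model_space (blaschke b)) A)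
    (r : 'M[R[i]]_(n.+1, m.+1))
    (r_repr : matrix_repr a b A r) :
  let beta' := cderiv (blaschke b) in
  (l = 0%N ->
    (ATTO (blaschke a) (blaschke b) A <->
     forall (p : 'I_m.+1) (s : 'I_n.+1),
       r s p =
         ((beta' (b s))^* * ((a ord0)^* - (b s)^*) * r s ord0
          + (beta' (b ord0))^* * ((b ord0)^* - (a ord0)^*) * r ord0 ord0
          + (beta' (b ord0))^* * ((a p)^* - (b ord0)^*) * r ord0 p)
         / ((beta' (b s))^* * ((a p)^* - (b s)^*)))) /\
  ((0 < l)%N ->
    (ATTO (blaschke a) (blaschke b) A <->
     (forall (p : 'I_m.+1) (s : 'I_n.+1),
       (s < l)%N -> (s : nat) <> p ->
       r s p =
         ((beta' (b ord0))^* * ((a ord0)^* - (b s)^*) * r ord0 (inord s)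
          + (beta' (b ord0))^* * ((a p)^* - (b ord0)^*) * r ord0 p)
         / ((beta' (b s))^* * ((a p)^* - (b s)^*))) /\
     (forall (p : 'I_m.+1) (s : 'I_n.+1),
       (l <= s)%N ->
       r s p =
         ((beta' (b s))^* * ((a ord0)^* - (b s)^*) * r s ord0
          + (beta' (b ord0))^* * ((a p)^* - (b ord0)^*) * r ord0 p)
         / ((beta' (b s))^* * ((a p)^* - (b s)^*))))).
Proof.
move=> beta'.
have [lm _ zeros] := common_zeros a_inj b_inj card_common common.
pose W p s := (beta' (b s))^* * ((a p)^* - (b s)^*) * r s p.
have separated : ATTO (blaschke a) (blaschke b) A <->
    exists U : R[i] -> R[i], forall p s, W p s = U (a p) - U (b s).
  split; first exact: (ATTO_separated a_disk b_disk b_inj A_lin r_repr).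
  by move=> [U]; exact: (separated_ATTO a_disk b_disk a_inj b_inj A_lin r_repr).
(* Away from common zeros each formula of the statement is an equation for the
   entry W p s, whose left factor is invertible. *)
have solve p s N : a p <> b s ->
    (r s p = N / ((beta' (b s))^* * ((a p)^* - (b s)^*))) <-> (W p s = N).
  move=> ps; have d0 : (beta' (b s))^* * ((a p)^* - (b s)^*) != 0.
    rewrite mulf_neq0//.
      by rewrite conjC_eq0 /beta' blaschke_cderiv// dual_kernel_neq0.
    by rewrite -rmorphB conjC_eq0 subr_eq0; exact/eqP.
  split=> [e|<-]; first by rewrite /W e mulrC divfK.
  by rewrite /W [X in X / _]mulrC mulfK.
clearbody beta'.
split=> [l0|l0].
  have disjoint p s : a p <> b s by move=> /zeros[_]; rewrite l0.
  rewrite separated; split=> [[U WU] p s|HW].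
    apply/solve => //.
    transitivity (W ord0 s - W ord0 ord0 + W p ord0); last by rewrite /W; ring.
    by rewrite !WU; ring.
  (* W is recovered from its first row and column. *)
  have [p s /disjoint//|U [Ua Ub]] := @glue_functions _ _ _ _ a b (fun p => W p ord0)
    (fun s => W ord0 ord0 - W ord0 s) 0 a_inj b_inj.
  exists U => p s; rewrite Ua Ub.
  by rewrite ((solve _ _ _ (disjoint p s)).1 (HW p s)) /W; ring.
have ab0 : a ord0 = b ord0 by exact: common.
have ab (s : 'I_n.+1) : (s < l)%N -> a (inord s) = b s.
  by move=> sl; apply: common; rewrite inordK// (leq_trans sl).
have diag p s : a p = b s -> W p s = 0 by move=> ps; rewrite /W ps subrr mulr0 mul0r.
rewrite separated; split=> [[U WU]|[HW1 HW2]].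
  split=> p s ls.
    move=> sp; apply/solve; first by move=> /zeros[ps _]; apply: sp.
    transitivity (W p ord0 - W (inord s) ord0); last by rewrite /W (ab s ls) ab0; ring.
    by rewrite !WU (ab s ls); ring.
  apply/solve; first by move=> /zeros[ps]; rewrite ps ltnNge ls.
  transitivity (W ord0 s + W p ord0); last by rewrite /W.
  by rewrite !WU ab0; ring.
(* Now W ord0 ord0 = 0; at a common zero b s the value of U is imposed by the
   row of a (inord s) = b s, elsewhere it is read off from the first column. *)
have [p s ps|U [Ua Ub]] := @glue_functions _ _ _ _ a b (fun p => W p ord0)
  (fun s : 'I_n.+1 => if (s < l)%N then W (inord s) ord0 else - W ord0 s) 0 a_inj b_inj.
  have [e pl] := zeros _ _ ps; rewrite -e pl; congr W; apply: val_inj => /=.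
  by rewrite inordK.
exists U => p s; rewrite Ua Ub; case: ltnP => sl.
  have [ps|ps] := eqVneq (a p) (b s).
    by rewrite diag// -(a_inj _ _ (etrans ps (esym (ab s sl)))) subrr.
  have sp : (s : nat) <> p.
    by move=> sp; move/eqP: ps; apply; apply: common => //; rewrite -sp.
  rewrite ((solve _ _ _ (elimN eqP ps)).1 (HW1 p s sl sp)).
  by rewrite /W (ab s sl) ab0; ring.
have ps : a p <> b s by move=> /zeros[ps]; rewrite ps ltnNge sl.
by rewrite ((solve _ _ _ ps).1 (HW2 p s sl)) /W opprK addrC.
Qed.
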